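(* Assume that the homogeneous part $\dot x=A(u(t))x$ satisfies the accessibility rank condition on $\mathbb R^n\setminus\{0\}$, that there is a $\sigma$-periodic $u\in\mathcal U_{pc}$ ($\sigma>0$) with $g(u)\in\mathcal S_\sigma\cap\mathrm{int}(\mathcal S)$ and $1\notin\mathrm{spec}(\Phi_u(\sigma,0))$, and that the affine system has at most finitely many control sets with nonvoid interior. Then for every control set ${}_{\mathbb R}D_i^{\hom}\subset\mathbb R^n\setminus\{0\}$ with nonvoid interior of the homogeneous part there is a control set $D\subset\mathbb R^n$ with nonvoid interior of the affine system such that $\partial_\infty(D)\cap e({}_{\mathbb P}D_i^{\hom})\neq\varnothing$, where ${}_{\mathbb P}D_i^{\hom}$ is the control set in $\mathbb P^{n-1}$ containing $\pi_{\mathbb P}({}_{\mathbb R}D_i^{\hom})$.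
   Context: Affine system $\dot x=A(u(t))x+Cu(t)+d$, $u(t)\in\Omega$, $A(u)=A+\sum_iu_iB_i$, $C=(c_1,\dots,c_m)$, $\Omega\subset\mathbb R^m$ bounded with $0\in\Omega$, satisfying the accessibility rank condition on $\mathbb R^n$; $\mathcal U_{pc}$ piecewise constant $\Omega$-valued controls; homogeneous part $\dot x=A(u(t))x$ with solutions $\varphi_{\hom}$ and principal fundamental solution $\Phi_u(t,s)$; it induces systems on $\mathbb R^n\setminus\{0\}$ and on $\mathbb P^{n-1}$ (trajectories $\pi_{\mathbb P}\varphi_{\hom}(t,x,u)$). $\mathcal S$: system semigroup in $\mathbb R^n\ltimes GL(n,\mathbb R)$ generated by time-$t$ maps ($t>0$) of $x\mapsto A(w)x+Cw+d$, $w\in\Omega$; $\mathcal S_\sigma$: elements of total time $\sigma$; interior in the generated group (Lie group topology); $g(u)\in\mathcal S_\sigma$ the element corresponding to $u$ on $[0,\sigma]$, so $g(u)x=\varphi(\sigma,x,u)$. Control set (on any state space): nonvoid maximal $D$ such that each $x\in D$ admits a control keeping the trajectory in $D$ for $t\ge0$ and $D\subset\overline{\mathcal O^+(x)}$ for all $x\in D$. Projective setting: bilinear system on $\mathbb R^{n+1}$, $\frac d{dt}(x,z)=\big(\begin{pmatrix}A&d\\0&0\end{pmatrix}+\sum_iu_i\begin{pmatrix}B_i&c_i\\0&0\end{pmatrix}\big)(x,z)$, projected to $\mathbb P^n$; $\mathbb P^{n,0}=\{[x_1:\cdots:x_n:0]\}$; $e([x_1:\cdots:x_n])=[x_1:\cdots:x_n:0]$;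 for a control set $D\subset\mathbb R^n$, $\partial_\infty(D):=\partial(\{[x_1:\cdots:x_n:1]:x\in D\})\cap\mathbb P^{n,0}$. *)

(* Defs.v *)
From HB Require Import structures.
From mathcomp Require Import all_boot all_order all_algebra.
From mathcomp Require Import all_classical all_reals all_analysis.
Set Implicit Arguments. Unset Strict Implicit. Unset Printing Implicit Defensive.
Import Order.TTheory GRing.Theory Num.Theory.
Import numFieldNormedType.Exports.
Local Open Scope ring_scope.
Local Open Scope classical_set_scope.

Section Defs.
Variable R : realType.

(* sup-norm of a matrix (all norms on R^k are equivalent) *)
Definition mxnorm p q (M : 'M[R]_(p, q)) : R :=
  \big[Num.max/0]_(i < p) \big[Num.max/0]_(j < q) `|M i j|.

Definition expm k (M : 'M[R]_k) : 'M[R]_k :=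
  \matrix_(i, j) limn (fun N : nat => \sum_(l < N) (l`!%:R)^-1 * (M ^+ l) i j).

Inductive liealg k (G : set 'M[R]_k) : 'M[R]_k -> Prop :=
| la_gen Z : G Z -> liealg G Z
| la_zero : liealg G 0
| la_add Z1 Z2 : liealg G Z1 -> liealg G Z2 -> liealg G (Z1 + Z2)
| la_scale (c : R) Z : liealg G Z -> liealg G (c *: Z)
| la_br Z1 Z2 : liealg G Z1 -> liealg G Z2 -> liealg G (Z1 *m Z2 - Z2 *m Z1).

Definition closureR k (A : set 'cV[R]_k) : set 'cV[R]_k :=
  [set y | forall e : R, 0 < e -> exists2 a, A a & mxnorm (y - a) < e].
Definition has_interior k (A : set 'cV[R]_k) : Prop :=
  exists x, exists2 e : R, 0 < e & forall y, mxnorm (y - x) < e -> A y.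

(* ---- projective space P^{k-1}: points [x] represented by nonzero x in R^k,
   subsets by scale-invariant sets of nonzero vectors (cones); topology is the
   quotient topology, with basic neighbourhoods {[z] | exists c, |y - c z| < e} ---- *)
Definition cone k (A : set 'cV[R]_k) : Prop :=
  (forall x, A x -> x != 0) /\ (forall x (c : R), A x -> c != 0 -> A (c *: x)).
Definition nbhsP k (y : 'cV[R]_k) (e : R) : set 'cV[R]_k :=
  [set z | z != 0 /\ exists2 c : R, c != 0 & mxnorm (y - c *: z) < e].
Definition closureP k (A : set 'cV[R]_k) : set 'cV[R]_k :=
  [set y | y != 0 /\ forall e : R, 0 < e -> exists z, A z /\ nbhsP y e z].
Definition interiorP k (A : set 'cV[R]_k) : set 'cV[R]_k :=
  [set y | y != 0 /\ exists2 e : R, 0 < e & nbhsP y e `<=` A].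
Definition boundaryP k (A : set 'cV[R]_k) : set 'cV[R]_k :=
  closureP A `&` ~` interiorP A.

(* ---- control systems given by flows for constant controls ---- *)
Variables (m k : nat).
Implicit Types (F : 'cV[R]_m -> R -> 'cV[R]_k -> 'cV[R]_k) (Om : set 'cV[R]_m).

(* state after applying a finite sequence of constant pieces (value, duration) *)
Definition run F (s : seq ('cV[R]_m * R)) (x : 'cV[R]_k) : 'cV[R]_k :=
  foldl (fun y p => F p.1 p.2 y) x s.

Definition orbit_pos F Om (x : 'cV[R]_k) : set 'cV[R]_k :=
  [set y | exists s : seq ('cV[R]_m * R),
     (forall p, p \in s -> Om p.1 /\ 0 <= p.2) /\ y = run F s x].

Fixpoint stateN F (w : nat -> 'cV[R]_m) (tau : nat -> R) (x : 'cV[R]_k) (j : nat)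
  : 'cV[R]_k :=
  if j is j'.+1 then F (w j') (tau j') (stateN F w tau x j') else x.

(* an Om-valued piecewise constant control on [0, oo) (pieces (w j, tau j),
   tau j > 0, no accumulation of switching times) keeps the trajectory from x in D *)
Definition can_stay F Om (D : set 'cV[R]_k) (x : 'cV[R]_k) : Prop :=
  exists (w : nat -> 'cV[R]_m) (tau : nat -> R),
    [/\ forall j, Om (w j), forall j, 0 < tau j,
        forall T : R, exists N, T <= \sum_(j < N) tau j &
        forall j (s : R), 0 <= s <= tau j -> D (F (w j) s (stateN F w tau x j))].

Definition ctrl_pre F Om (X D : set 'cV[R]_k) : Prop :=
  [/\ D `<=` X, D !=set0,
      forall x, D x -> can_stay F Om D x &
      forall x, D x -> D `<=` closureR (orbit_pos F Om x)].
Definition control_set F Om (X D : set 'cV[R]_k) : Prop :=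
  ctrl_pre F Om X D /\
  (forall D', ctrl_pre F Om X D' -> D `<=` D' -> D' = D).

(* control set of the induced system on P^{k-1} (for a linear system F);
   sets of P^{k-1} are represented by cones *)
Definition ctrl_preP F Om (D : set 'cV[R]_k) : Prop :=
  [/\ cone D, D !=set0,
      forall x, D x -> can_stay F Om D x &
      forall x, D x -> D `<=` closureP (orbit_pos F Om x)].
Definition control_setP F Om (D : set 'cV[R]_k) : Prop :=
  ctrl_preP F Om D /\
  (forall D', ctrl_preP F Om D' -> D `<=` D' -> D' = D).

End Defs.

Section Affine.
Variables (R : realType) (n m : nat).
Variables (A : 'M[R]_n) (B : 'I_m -> 'M[R]_n) (C : 'M[R]_(n, m)) (d : 'cV[R]_n).

Definition Au (w : 'cV[R]_m) : 'M[R]_n := A + \sum_(i < m) w i 0 *: B i.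
(* the affine vector field x |-> A(w) x + C w + d in homogeneous coordinates;
   this also identifies R^n x| GL(n,R) with a subgroup of GL(n+1,R) *)
Definition Mhat (w : 'cV[R]_m) : 'M[R]_(n + 1) :=
  block_mx (Au w) (C *m w + d) 0 0.

Definition Faff (w : 'cV[R]_m) (t : R) (x : 'cV[R]_n) : 'cV[R]_n :=
  usubmx (expm (t *: Mhat w) *m col_mx x 1).
Definition Fhom (w : 'cV[R]_m) (t : R) (x : 'cV[R]_n) : 'cV[R]_n :=
  expm (t *: Au w) *m x.

Definition ARC_aff (Om : set 'cV[R]_m) : Prop :=
  forall x y : 'cV[R]_n, exists2 Z, liealg [set Mhat w | w in Om] Z &
    usubmx (Z *m col_mx x 1) = y.
Definition ARC_hom (Om : set 'cV[R]_m) : Prop :=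
  forall x : 'cV[R]_n, x != 0 -> forall y : 'cV[R]_n,
    exists2 Z, liealg [set Au w | w in Om] Z & Z *m x = y.

Definition gel (s : seq ('cV[R]_m * R)) : 'M[R]_(n + 1) :=
  foldl (fun g p => expm (p.2 *: Mhat p.1) *m g) 1%:M s.
Definition Phi (s : seq ('cV[R]_m * R)) : 'M[R]_n :=
  foldl (fun g p => expm (p.2 *: Au p.1) *m g) 1%:M s.
Definition total_time (s : seq ('cV[R]_m * R)) : R := \sum_(p <- s) p.2.
Definition admissible (Om : set 'cV[R]_m) (s : seq ('cV[R]_m * R)) : Prop :=
  forall p, p \in s -> Om p.1 /\ 0 < p.2.

Definition semigroupS (Om : set 'cV[R]_m) : set 'M[R]_(n + 1) :=
  [set g | exists2 s, (s != [::]) /\ admissible Om s & g = gel s].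
(* interior of S in the system group G, with its Lie group topology: G is the
   connected Lie subgroup with Lie algebra L generated by the Mhat w, and
   the sets g exp(Z), Z in L small, form a neighbourhood base of g in G *)
Definition in_int_S (Om : set 'cV[R]_m) (g : 'M[R]_(n + 1)) : Prop :=
  exists2 e : R, 0 < e & forall Z, liealg [set Mhat w | w in Om] Z ->
    mxnorm Z < e -> semigroupS Om (g *m expm Z).

Definition embedP (D : set 'cV[R]_n) : set 'cV[R]_(n + 1) :=
  [set v | exists y, D y /\ exists2 c : R, c != 0 & v = c *: col_mx y 1].

End Affine.

(* Main.v *)
Require Import Defs.
From HB Require Import structures.
From mathcomp Require Import all_boot all_order all_algebra.
From mathcomp Require Import all_classical all_reals all_analysis.
From mathcomp Require Import ring lra.
Set Implicit Arguments. Unset Strict Implicit. Unset Printing Implicit Defensive.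
Import Order.TTheory GRing.Theory Num.Theory.
Import numFieldNormedType.Exports.
Local Open Scope ring_scope.
Local Open Scope classical_set_scope.

(* The system Lie algebra is spanned by the partial derivatives, in the durations, of
   some arbitrarily short word of constant controls; moving through such a word makes
   the reachability relation open in both endpoints, so a fixed point of a word
   containing one lies in the interior of a control set. Near an interior point of the
   homogeneous control set there is a point x of it and a loop with Phi x = x which
   contains such a word for each of the two systems. Deform the loop analytically
   towards the given word with 1 not in the spectrum: for arbitrarily small
   deformations the affine map has a fixed point, these lie in finitely many control
   sets, and in P^n they cluster at a fixed point of the loop. If that point is [v :
   0], it lies at infinity and Phi v = v. Otherwise it is a point y of R^n fixed by the
   affine map of the loop, and then so are all points y + c x: they lie in one control
   set, which goes to infinity in direction v := x. Unless v is a multiple of x, the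
   loop fixes every point of the line through x and v, which avoids 0, so x and v are
   mutually reachable and v belongs to the projective control set. *)

Section MatrixTopology.
Context {R : realType}.

Lemma mx_norm_leP p q (M : 'M[R]_(p, q)) e : 0 <= e ->
  `|M| <= e <-> forall i j, `|M i j| <= e.
Proof.
move=> e0; rewrite [`|M|]mx_normrE; split=> [h i j|h].
  by apply: le_trans h; exact: (le_bigmax _ (fun ij => `|M ij.1 ij.2|) (i, j)).
by apply: bigmax_le => // -[i j] _; exact: h.
Qed.

Lemma mx_norm_ltP p q (M : 'M[R]_(p, q)) e : 0 < e ->
  `|M| < e <-> forall i j, `|M i j| < e.
Proof.
move=> e0; rewrite [`|M|]mx_normrE; split=> [h i j|h].
  by apply: le_lt_trans h; exact: (le_bigmax _ (fun ij => `|M ij.1 ij.2|) (i, j)).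
by apply: bigmax_lt => // -[i j] _; exact: h.
Qed.

Lemma mx_entry_norm_le p q (M : 'M[R]_(p, q)) i j : `|M i j| <= `|M|.
Proof. by move: i j; apply/mx_norm_leP. Qed.

Lemma mxnormE p q (M : 'M[R]_(p, q)) : mxnorm M = `|M|.
Proof.
apply/eqP; rewrite eq_le; apply/andP; split.
  by apply: bigmax_le => // i _; apply: bigmax_le => // j _; exact: mx_entry_norm_le.
have le_mxnorm i j : `|M i j| <= mxnorm M.
  by apply: le_trans (le_bigmax _ _ i); exact: (le_bigmax _ (fun j => `|M i j|) j).
by apply/mx_norm_leP => //; exact: bigmax_ge_id.
Qed.

Lemma closureRE k (A : set 'cV[R]_k) : closureR A = closure A.
Proof.
apply/seteqP; split=> y Ay => [V /nbhs_ballP[e e0 eV]|e e0].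
  have [a Aa ya] := Ay e e0; exists a; split=> //; apply: eV.
  by rewrite mx_norm_ball /ball_ /= -mxnormE.
have [a [Aa ya]] := Ay _ (nbhsx_ballx y e e0); exists a => //.
by move: ya; rewrite mx_norm_ball /ball_ /= mxnormE.
Qed.

Lemma has_interiorP k (A : set 'cV[R]_k) : has_interior A <-> A° !=set0.
Proof.
split=> [[x [e e0 eA]]|[x /nbhs_ballP[e e0 eA]]]; exists x.
  apply/nbhs_ballP; exists e => // y; rewrite mx_norm_ball /ball_ /= distrC -mxnormE.
  exact: eA.
by exists e => // y; rewrite mxnormE distrC => xy; apply: eA; rewrite mx_norm_ball.
Qed.

Lemma mx_norm_mulmx p q r (M : 'M[R]_(p, q)) (N : 'M[R]_(q, r)) :
  `|M *m N| <= q%:R * `|M| * `|N|.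
Proof.
apply/mx_norm_leP => [|i j]; first by rewrite !mulr_ge0.
rewrite mxE (le_trans (ler_norm_sum _ _ _))//.
rewrite (_ : q%:R * _ * _ = \sum_(l < q) `|M| * `|N|); last first.
  by rewrite sumr_const card_ord -mulrA mulr_natl.
by apply: ler_sum => l _; rewrite normrM ler_pM// mx_entry_norm_le.
Qed.

Lemma cvg_mxP T (F : set_system T) {FF : Filter F} p q
    (f : T -> 'M[R]_(p, q)) (M : 'M[R]_(p, q)) :
  f @ F --> M <-> forall i j, f x i j @[x --> F] --> M i j.
Proof.
split=> [fM i j|fM].
  exact: (cvg_comp _ _ fM (@coord_continuous _ _ _ i j M)).
apply/cvgrPdist_lt => e e0.
have : \forall x \near F, forall ij : 'I_p * 'I_q,
    `|M ij.1 ij.2 - f x ij.1 ij.2| < e.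
  by apply: filter_forall => -[i j]; move/cvgrPdist_lt: (fM i j); apply.
apply: filterS => x fx; apply/mx_norm_ltP => // i j.
by rewrite !mxE; exact: (fx (i, j)).
Qed.

Lemma cvg_mulmx T (F : set_system T) {FF : Filter F} p q r (f : T -> 'M[R]_(p, q))
    (g : T -> 'M[R]_(q, r)) (M : 'M[R]_(p, q)) (N : 'M[R]_(q, r)) :
  f @ F --> M -> g @ F --> N -> f x *m g x @[x --> F] --> M *m N.
Proof.
move=> /cvg_mxP fM /cvg_mxP gN; apply/cvg_mxP => i j.
rewrite mxE; under eq_cvg do rewrite mxE.
apply: cvg_big => [|l _]; first exact: add_continuous.
by apply: cvgM.
Qed.

Lemma cvg_col_mx T (F : set_system T) {FF : Filter F} p q r (f : T -> 'M[R]_(p, r))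
    (g : T -> 'M[R]_(q, r)) (M : 'M[R]_(p, r)) (N : 'M[R]_(q, r)) :
  f @ F --> M -> g @ F --> N -> col_mx (f x) (g x) @[x --> F] --> col_mx M N.
Proof.
move=> /cvg_mxP fM /cvg_mxP gN; apply/cvg_mxP => i j.
rewrite mxE; under eq_cvg do rewrite mxE.
by case: (fintype.split i) => i'; [exact: fM|exact: gN].
Qed.

Lemma linear_mx_continuous p q (V : normedModType R)
  (f : {linear 'M[R]_(p, q) -> V}) : continuous f.
Proof.
rewrite (_ : (f : _ -> _) = fun X => \sum_i \sum_j X i j *: f (delta_mx i j)); last first.
  apply/funext => X; rewrite {1}(matrix_sum_delta X) linear_sum.
  by apply: eq_bigr => i _; rewrite linear_sum; apply: eq_bigr => j _; rewrite linearZ.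
apply: continuous_big => [|i _]; first exact: add_continuous.
apply: continuous_big => [|j _]; first exact: add_continuous.
by move=> M; apply: (@cvgZr_tmp _ _ _ (nbhs M)); exact: coord_continuous.
Qed.

Lemma det_continuous k : continuous (fun M : 'M[R]_k => \det M).
Proof.
apply: continuous_big => [|s _ M]; first exact: add_continuous.
apply: (@cvgMl_tmp _ _ (nbhs M)); move: M.
apply: continuous_big => [|i _]; first exact: mul_continuous.
exact: coord_continuous.
Qed.

Lemma is_deriveP (V W : normedModType R) (f : V -> W) x v df :
  is_derive x v f df <-> h^-1 *: (f (h *: v + x) - f x) @[h --> 0^'] --> df.
Proof.
split=> [[fx <-]//|f_df]; have fx : derivable f x v by apply/cvg_ex; exists df.
by apply: DeriveDef => //; exact/cvg_lim.
Qed.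

Lemma is_derive_mxP (V : normedModType R) p q (F : V -> 'M[R]_(p, q)) x v dF :
  is_derive x v F dF <-> forall i j, is_derive x v (fun y => F y i j) (dF i j).
Proof.
rewrite is_deriveP cvg_mxP; split=> F_dF i j; have := F_dF i j.
  by move=> h; apply/is_deriveP; move: h; under eq_cvg do rewrite !mxE.
by move/is_deriveP; under [in X in _ -> X]eq_cvg do rewrite !mxE.
Qed.

Lemma is_derive_linear (V W : normedModType R) p q (F : V -> 'M[R]_(p, q))
    (f : {linear 'M[R]_(p, q) -> W}) x v dF :
  is_derive x v F dF -> is_derive x v (f \o F) (f dF).
Proof.
move=> /is_deriveP F_dF; apply/is_deriveP => /=.
under eq_cvg do rewrite -linearB -linearZ.
by apply: (cvg_comp _ _ F_dF); exact: linear_mx_continuous.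
Qed.

Lemma is_derive_mulmx (V : normedModType R) p q r (F : V -> 'M[R]_(p, q))
    (G : V -> 'M[R]_(q, r)) x v dF dG :
  is_derive x v F dF -> is_derive x v G dG ->
  is_derive x v (fun y => F y *m G y) (dF *m G x + F x *m dG).
Proof.
move=> /is_derive_mxP F_dF /is_derive_mxP G_dG; apply/is_derive_mxP => i j.
rewrite (_ : (fun y => _) = \sum_l (fun y => F y i l) * (fun y => G y l j)); last first.
  by apply/funext => y; rewrite mxE fct_sumE.
rewrite !mxE -big_split; apply: is_derive_sum => l.
apply: is_derive_eq (is_deriveM (F_dF i l) (G_dG l j)) _.
by rewrite addrC /GRing.scale /= mulrC.
Qed.

Lemma is_derive1_mx_comp p q (F : R -> 'M[R]_(p, q)) (g : R -> R) t dF dg :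
  is_derive (g t) 1 F dF -> is_derive t 1 g dg ->
  is_derive t 1 (F \o g) (dg *: dF).
Proof.
move=> /is_derive_mxP F_dF g_dg; apply/is_derive_mxP => i j.
by rewrite mxE mulrC; exact: (is_derive1_comp (F_dF i j) g_dg).
Qed.

Lemma is_derive1_affine (a b t : R) : is_derive t 1 (fun u => a + u * b) b.
Proof. by apply: is_derive_eq; rewrite add0r mul1r scaler0 add0r; exact: mulr1. Qed.

Lemma is_derive0_mx_cst p q (F : R -> 'M[R]_(p, q)) :
  (forall t : R, is_derive t 1 F 0) -> forall s t, F s = F t.
Proof.
move=> F0 s t; apply/matrixP => i j.
apply: (@is_derive_0_is_cst _ (fun u => F u i j)) => u.
by have /is_derive_mxP/(_ i j) := F0 u; rewrite mxE.
Qed.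

Lemma compact_unit_sphere k : compact [set v : 'cV[R]_k | `|v| = 1].
Proof.
have -> : [set v : 'cV[R]_k | `|v| = 1] = trmx @` [set u : 'rV[R]_k | `|u| = 1].
  have norm_trmx p q (M : 'M[R]_(p, q)) : `|M^T| = `|M|.
    apply/eqP; rewrite eq_le; apply/andP; split.
      by apply/mx_norm_leP => // i j; rewrite mxE mx_entry_norm_le.
    by apply/mx_norm_leP => // i j; have := mx_entry_norm_le M^T j i; rewrite mxE.
  apply/seteqP; split=> [v /= v1|_ [u /= u1 <-]]; last by rewrite norm_trmx.
  by exists v^T; rewrite ?trmxK ?norm_trmx.
apply: continuous_compact.
  by apply: continuous_subspaceT; exact: linear_mx_continuous.
apply: bounded_closed_compact.
  by exists 1; split=> // r r1 u /= ->; exact: ltW.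
apply: (@preimage_closed _ _ (fun u : 'rV[R]_k => `|u|) [set 1]); last exact: closed_eq.
by move=> u _; exact: norm_continuous.
Qed.

End MatrixTopology.

Section MatrixExponential.
Context {R : realType}.
Variable k : nat.
Implicit Types M : 'M[R]_k.

Lemma mx_norm_exprS M l : k%:R * `|M ^+ l.+1| <= (k%:R * `|M|) ^+ l.+1.
Proof.
elim: l => [//|l IHl]; rewrite exprS [leRHS]exprS.
apply: le_trans (ler_wpM2l _ (mx_norm_mulmx _ _)) _ => //.
by rewrite mulrCA ler_wpM2l // mulr_ge0.
Qed.

Lemma mx_entry_expr_le M l i j : `|(M ^+ l) i j| <= (k%:R * `|M|) ^+ l.
Proof.
case: l => [|l].
  by rewrite !expr0 mxE; case: eqP; rewrite ?normr1 ?normr0.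
apply: le_trans (mx_norm_exprS M l); apply: le_trans (mx_entry_norm_le _ i j) _.
by rewrite ler_peMl // ler1n; case: (k) i {j} => -[].
Qed.

Let exp_entry_coef M i j r : R^nat := fun l => (l`!%:R)^-1 * (M ^+ (l + r)) i j.

Let is_cvg_exp_entry M i j r x : cvgn (pseries (exp_entry_coef M i j r) x).
Proof.
set a := k%:R * `|M|; have a0 : 0 <= a by rewrite mulr_ge0.
apply: normed_cvg; apply: (@series_le_cvg _ _ (a ^+ r *: exp_coeff (a * `|x|))).
- by move=> l; exact: normr_ge0.
- by move=> l; rewrite mulr_ge0 ?exprn_ge0 // exp_coeff_ge0 // mulr_ge0.
- move=> l; rewrite /= !normrM normrX ger0_norm ?invr_ge0 //.
  rewrite (_ : (_ *: _) l = a ^+ r * ((a * `|x|) ^+ l / l`!%:R)) //.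
  rewrite -mulrA [leRHS]mulrA [leRHS]mulrC ler_wpM2l ?invr_ge0 //.
  by rewrite [(a * _) ^+ l]exprMn mulrA -exprD addnC ler_wpM2r ?exprn_ge0 // mx_entry_expr_le.
- by apply: is_cvg_seriesZ; exact: is_cvg_series_exp_coeff.
Qed.

Definition expm_psum M (N : nat) : 'M[R]_k := \sum_(l < N) (l`!%:R)^-1 *: M ^+ l.

Lemma expm_psum_cvg M : expm_psum M N @[N --> \oo] --> expm M.
Proof.
apply/cvg_mxP => i j; rewrite /expm mxE.
rewrite (_ : (fun N => expm_psum M N i j) = pseries (exp_entry_coef M i j 0) 1); last first.
  apply/funext => N; rewrite /pseries /series /= big_mkord /expm_psum summxE.
  by apply: eq_bigr => l _; rewrite expr1n mulr1 mxE /exp_entry_coef addn0.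
rewrite (_ : (fun N => \sum_(_ < _) _) = pseries (exp_entry_coef M i j 0) 1); last first.
  apply/funext => N; rewrite /pseries /series /= big_mkord.
  by apply: eq_bigr => l _; rewrite expr1n mulr1 /exp_entry_coef addn0.
exact: is_cvg_exp_entry.
Qed.

Lemma expm0 : expm (0 : 'M[R]_k) = 1%:M.
Proof.
have := @expm_psum_cvg 0; rewrite -cvg_shiftS => /cvg_lim <- //.
apply/cvg_lim => //; apply: cvg_near_cst; near=> N.
rewrite /= /expm_psum big_ord_recl fact0 invr1 scale1r expr0 big1 ?addr0 // => l _.
by rewrite exprS mul0r scaler0.
Unshelve. all: by end_near. Qed.

Lemma expm_commute M : expm M *m M = M *m expm M.
Proof.
have psum_commute N : expm_psum M N *m M = M *m expm_psum M N.
  rewrite mulmx_suml mulmx_sumr; apply: eq_bigr => l _.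
  by rewrite -scalemxAl -scalemxAr -[_ *m M]exprSr -[M *m _]exprS.
have cvg_left : M *m expm_psum M N @[N --> \oo] --> M *m expm M.
  by apply: cvg_mulmx; [exact: cvg_cst|exact: expm_psum_cvg].
have cvg_right : M *m expm_psum M N @[N --> \oo] --> expm M *m M.
  under eq_cvg do rewrite -psum_commute.
  by apply: cvg_mulmx; [exact: expm_psum_cvg|exact: cvg_cst].
exact: (cvg_unique (@norm_hausdorff _ _) cvg_right cvg_left).
Qed.

Lemma mx_norm_expm_sub1 M : k%:R * `|expm M - 1%:M| <= expR (k%:R * `|M|) - 1.
Proof.
have cvg_norm : k%:R * `|expm_psum M N.+1 - 1%:M| @[N --> \oo] -->
    k%:R * `|expm M - 1%:M|.
  apply: cvgMl_tmp; apply: cvg_norm; apply: cvgB; last exact: cvg_cst.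
  by have := @expm_psum_cvg M; rewrite -cvg_shiftS.
apply: (cvgr_to_le cvg_norm) => /=; near=> N.
apply: (@le_trans _ _ (series (exp_coeff (k%:R * `|M|)) N.+1 - 1)).
  rewrite /expm_psum big_ord_recl fact0 invr1 scale1r expr0 addrC addKr.
  rewrite /series /= big_mkord big_ord_recl /exp_coeff /= fact0 divr1 expr0 addrC addKr.
  apply: le_trans (ler_wpM2l _ (ler_norm_sum _ _ _)) _; first exact: ler0n.
  rewrite mulr_sumr; apply: ler_sum => l _.
  rewrite normrZ ger0_norm ?invr_ge0 // mulrCA mulrC ler_wpM2r ?invr_ge0 //.
  exact: mx_norm_exprS.
rewrite lerD2r; apply: nondecreasing_cvgn_le.
  by apply: nondecreasing_series => l _; rewrite exp_coeff_ge0 // mulr_ge0.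
exact: is_cvg_series_exp_coeff.
Unshelve. all: by end_near. Qed.

Lemma exprZmx M t l : (t *: M) ^+ l = t ^+ l *: M ^+ l.
Proof.
elim: l => [|l IHl]; first by rewrite !expr0 scale1r.
by rewrite !exprS IHl -[LHS]scalemxAl -[X in t *: X]scalemxAr scalerA.
Qed.

Lemma is_derive_expm M (t : R) :
  is_derive t 1 (fun u : R => expm (u *: M)) (M *m expm (t *: M)).
Proof.
apply/is_derive_mxP => i j.
have diffsE r : pseries_diffs (exp_entry_coef M i j r) = exp_entry_coef M i j r.+1.
  apply/funext => l; rewrite /pseries_diffs /exp_entry_coef factS natrM invfM.
  by rewrite mulrA mulVKf // addSnnS.
have -> : (fun u => expm (u *: M) i j) = (fun u => limn (pseries (exp_entry_coef M i j 0) u)).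
  apply/funext => u; rewrite /expm mxE; congr (limn _); apply/funext => N.
  rewrite /pseries /series /= big_mkord; apply: eq_bigr => l _.
  by rewrite exprZmx mxE mulrCA mulrC /exp_entry_coef addn0.
have -> : (M *m expm (t *: M)) i j =
    limn (pseries (pseries_diffs (exp_entry_coef M i j 0)) t).
  apply/esym/cvg_lim => //.
  rewrite (_ : pseries _ t = fun N => (M *m expm_psum (t *: M) N) i j).
    move: i j {diffsE}; apply/cvg_mxP.
    by apply: cvg_mulmx; [exact: cvg_cst|exact: expm_psum_cvg].
  apply/funext => N.
  rewrite diffsE mulmx_sumr summxE /pseries /series /= big_mkord; apply: eq_bigr => l _.
  by rewrite /exp_entry_coef addn1 exprS exprZmx scalerA -scalemxAr [RHS]mxE mulrAC.
apply: (@pseries_snd_diffs _ _ (`|t| + 1)); rewrite ?diffsE; try exact: is_cvg_exp_entry.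
by rewrite [ltRHS]ger0_norm ?ltrDl // addr_ge0.
Qed.

Lemma cvg_expm T (F : set_system T) {FF : Filter F} (f : T -> R) (t : R) M :
  f @ F --> t -> expm (f x *: M) @[x --> F] --> expm (t *: M).
Proof.
suff cont_expm : continuous (fun u : R => expm (u *: M)).
  by move=> f_t; exact: (cvg_comp _ _ f_t (cont_expm t)).
move=> u; apply: differentiable_continuous; apply/derivable1_diffP.
by have [] := is_derive_expm M u.
Qed.

Lemma is_derive_expm_comp M (g : R -> R) (t dg : R) : is_derive t 1 g dg ->
  is_derive t 1 (fun u => expm (g u *: M)) (dg *: (M *m expm (g t *: M))).
Proof. exact: (@is_derive1_mx_comp _ _ _ (fun u : R => expm (u *: M))) (is_derive_expm _ _). Qed.

Lemma expmZ_commute M t : expm (t *: M) *m M = M *m expm (t *: M).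
Proof.
case: (eqVneq t 0) => [->|t0]; first by rewrite scale0r expm0 mulmx1 mul1mx.
by have := expm_commute (t *: M); rewrite -scalemxAr -[RHS]scalemxAl => /scalerI; apply.
Qed.

Section LinearODE.
Variables (q : nat) (M : 'M[R]_k) (F : R -> 'M[R]_(k, q)).
Hypothesis F_sol : forall t : R, is_derive t 1 F (M *m F t).

(* The derivative of [expm (- t *: M) *m F t] vanishes. *)
Lemma expmN_mul_solution t : expm (- t *: M) *m F t = F 0.
Proof.
have -> : F 0 = expm (- 0 *: M) *m F 0 by rewrite oppr0 scale0r expm0 mul1mx.
apply: (is_derive0_mx_cst (F := fun u => expm (- u *: M) *m F u)) => u.
apply: is_derive_eq (is_derive_mulmx (is_derive_expm_comp M _) (F_sol u)) _.
by rewrite scaleN1r mulNmx [in X in _ + X]mulmxA expmZ_commute addNr.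
Qed.

End LinearODE.

Lemma expmNK M t : expm (- t *: M) *m expm (t *: M) = 1%:M.
Proof.
by rewrite (expmN_mul_solution (is_derive_expm M)) scale0r expm0.
Qed.

Lemma expm_unit M t : expm (t *: M) \in unitmx.
Proof. by have /mulmx1_unit[] := expmNK M t. Qed.

Lemma invmx_expm M t : invmx (expm (t *: M)) = expm (- t *: M).
Proof. by rewrite -[LHS]mul1mx -(expmNK M t) mulmxK // expm_unit. Qed.

Lemma linear_ode_flow q M (F : R -> 'M[R]_(k, q)) :
  (forall t : R, is_derive t 1 F (M *m F t)) ->
  forall s t, F (s + t) = expm (t *: M) *m F s.
Proof.
move=> F_sol s t.
have shift_sol (u : R) : is_derive u 1 (fun v => F (v + s)) (M *m F (u + s)).
  exact: is_derive_eq (is_derive1_mx_comp (F_sol _) (is_derive_shift u 1 s)) (scale1r _).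
have := expmN_mul_solution shift_sol t; rewrite add0r addrC => <-.
by rewrite -invmx_expm mulKVmx // expm_unit.
Qed.

Lemma expmDZ M s t : expm ((s + t) *: M) = expm (t *: M) *m expm (s *: M).
Proof. exact: (linear_ode_flow (F := fun u => expm (u *: M)) (is_derive_expm M)). Qed.

End MatrixExponential.

Section BohlFunctions.
Context {R : realType}.
Implicit Types f g : R -> R.

(* The outputs [u F] of linear systems [F' = K F]: an algebra of analytic
   functions for which the identity theorem is elementary. *)
Definition bohl f := exists N (K : 'M[R]_N) (F : R -> 'cV[R]_N) (u : 'rV[R]_N),
  (forall t : R, is_derive t 1 F (K *m F t)) /\ forall t, f t = (u *m F t) 0 0.

Definition bohl_mx p q (F : R -> 'M[R]_(p, q)) := forall i j, bohl (fun t => F t i j).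

Lemma bohl_cst c : bohl (cst c).
Proof.
exists 1, 0, (cst 1%:M), c%:M; split=> t; last by rewrite mulmx1 mxE eqxx mulr1n.
by rewrite mul0mx; exact: is_derive_cst.
Qed.

Lemma bohlD f g : bohl f -> bohl g -> bohl (f + g).
Proof.
move=> [N [K [F [u [F_sol fE]]]]] [N' [K' [G [v [G_sol gE]]]]].
exists (N + N')%N, (block_mx K 0 0 K'), (fun t => col_mx (F t) (G t)), (row_mx u v).
split=> t; last by rewrite mul_row_col mxE -fE -gE.
rewrite mul_block_col !mul0mx addr0 add0r; apply/is_derive_mxP => i j.
rewrite mxE; under eq_fun do rewrite mxE.
by case: (fintype.split i) => i'; [move/is_derive_mxP: (F_sol t)|move/is_derive_mxP: (G_sol t)].
Qed.

(* The tensor product [F G^T] of two solutions solves [X' = K X + X K'^T]. *)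
Lemma bohlM f g : bohl f -> bohl g -> bohl (f * g).
Proof.
move=> [N [K [F [u [F_sol fE]]]]] [N' [K' [G [v [G_sol gE]]]]].
pose L := mulmx K \+ mulmxr K'^T : 'M[R]_(N, N') -> 'M[R]_(N, N').
exists (N * N')%N, (lin_mx L)^T, (fun t => (mxvec (F t *m (G t)^T))^T), (mxvec (u^T *m v)).
split=> t; last first.
  rewrite mxvec_dotmul mulmxA -mulmxA -trmx_mul.
  by rewrite [u *m _]mx11_scalar [v *m _]mx11_scalar -fE -gE tr_scalar_mx -scalar_mxM mxE.
rewrite -trmx_mul mul_vec_lin /L /=.
apply: (is_derive_linear (trmx \o mxvec)).
apply: is_derive_eq (is_derive_mulmx (F_sol t) (is_derive_linear trmx (G_sol t))) _.
by rewrite /= trmx_mul !mulmxA.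
Qed.

Lemma bohlN f : bohl f -> bohl (- f).
Proof. by rewrite -mulN1r; exact: bohlM (bohl_cst (-1)). Qed.

Lemma bohl_sum I (r : seq I) (P : pred I) (f : I -> R -> R) :
  (forall i, P i -> bohl (f i)) -> bohl (fun t => \sum_(i <- r | P i) f i t).
Proof.
move=> bohl_f; rewrite -fct_sumE.
by elim/big_ind : _ => //; [exact: bohl_cst 0|exact: bohlD].
Qed.

Lemma bohl_prod I (r : seq I) (P : pred I) (f : I -> R -> R) :
  (forall i, P i -> bohl (f i)) -> bohl (fun t => \prod_(i <- r | P i) f i t).
Proof.
move=> bohl_f; rewrite -fct_prodE.
by elim/big_ind : _ => //; [exact: bohl_cst 1|exact: bohlM].
Qed.

Lemma bohl_mx_cst p q (M : 'M[R]_(p, q)) : bohl_mx (cst M).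
Proof. by move=> i j; exact: bohl_cst. Qed.

Lemma bohl_mulmx p q r (F : R -> 'M[R]_(p, q)) (G : R -> 'M[R]_(q, r)) :
  bohl_mx F -> bohl_mx G -> bohl_mx (fun t => F t *m G t).
Proof.
move=> bohl_F bohl_G i j; under eq_fun do rewrite mxE.
by apply: bohl_sum => l _; exact: bohlM.
Qed.

Lemma bohl_mxB p q (F G : R -> 'M[R]_(p, q)) :
  bohl_mx F -> bohl_mx G -> bohl_mx (fun t => F t - G t).
Proof.
move=> bohl_F bohl_G i j; under eq_fun do rewrite 2!mxE.
by apply: bohlD => //; exact: bohlN.
Qed.

Lemma bohl_det p (F : R -> 'M[R]_p) : bohl_mx F -> bohl (fun t => \det (F t)).
Proof.
move=> bohl_F; apply: bohl_sum => s _; apply: bohlM; first exact: bohl_cst.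
by apply: bohl_prod => i _; exact: bohl_F.
Qed.

Lemma bohl_expm k (M : 'M[R]_k) a b : bohl_mx (fun t => expm ((a + t * b) *: M)).
Proof.
move=> i j.
exists k, (b *: M), (fun t => expm ((a + t * b) *: M) *m delta_mx j 0), (delta_mx 0 i).
split=> t; last by rewrite -colE -rowE !mxE.
apply: is_derive_eq (is_derive_mulmx (is_derive_expm_comp M (is_derive1_affine a b t))
  (is_derive_cst _ _ _)) _.
by rewrite mulmx0 addr0 -!scalemxAl mulmxA.
Qed.

Lemma bohl_derive N (K : 'M[R]_N) (F : R -> 'cV[R]_N) (u : 'rV[R]_N) (t : R) :
  is_derive t 1 F (K *m F t) ->
  is_derive t 1 (fun s => (u *m F s) 0 0) ((u *m K *m F t) 0 0).
Proof.
move=> F_sol; have /is_derive_mxP := is_derive_linear (mulmx u) F_sol.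
by rewrite -mulmxA; apply.
Qed.

Lemma bohl_continuous f : bohl f -> continuous f.
Proof.
move=> [N [K [F [u [F_sol /funext ->]]]]] t.
apply: differentiable_continuous; apply/derivable1_diffP.
by have [] := bohl_derive u (F_sol t).
Qed.

Lemma bohl_mx_continuous p q (F : R -> 'M[R]_(p, q)) : bohl_mx F -> continuous F.
Proof. by move=> bohl_F t; apply/cvg_mxP => i j; exact: bohl_continuous. Qed.

Lemma bohl_near0_eq0 f : bohl f -> (\forall t \near 0^'+, f t = 0) -> forall t, f t = 0.
Proof.
move=> [N [K [F [u [F_sol fE]]]]] [e /= e0 f0] t.
have deriv0 l s : 0 < s < e -> (u *m K ^+ l *m F s) 0 0 = 0.
  elim: l s => [|l IHl] s /andP[s0 se].
    by rewrite mulmx1 -fE f0 //= sub0r normrN gtr0_norm.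
  have der_l := bohl_derive (u *m K ^+ l) (F_sol s).
  have der_0 : is_derive s 1 (fun v => (u *m K ^+ l *m F v) 0 0) 0.
    apply: (@near_eq_is_derive _ _ _ (cst (0 : R))).
    have /near_in_itvoo : s \in `]0, e[%R by rewrite in_itv /= s0.
    by apply: filterS => v; rewrite in_itv /= => /IHl ->.
  by rewrite exprSr mulmxA -(@derive_val _ _ _ _ _ _ _ der_l) (@derive_val _ _ _ _ _ _ _ der_0).
set c := e / 2; have c_e : 0 < c < e by apply/andP; split; rewrite /c; lra.
rewrite fE -(subrK c t) addrC (linear_ode_flow F_sol) mulmxA; set X := (t - c) *: K.
have psum0 M : (u *m expm_psum X M *m F c) = 0.
  rewrite mulmx_sumr mulmx_suml big1 // => l _; apply/matrixP => i j.
  rewrite exprZmx -!scalemxAr -!scalemxAl !ord1 2!mxE deriv0 //.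
  by rewrite !mulr0 mxE.
have cvg_psum : u *m expm_psum X M *m F c @[M --> \oo] --> u *m expm X *m F c.
  apply: cvg_mulmx; last exact: cvg_cst.
  by apply: cvg_mulmx; [exact: cvg_cst|exact: expm_psum_cvg].
suff -> : u *m expm X *m F c = 0 by rewrite mxE.
apply: (cvg_unique (@norm_hausdorff _ _) cvg_psum).
by apply: cvg_near_cst; exact: nearW.
Qed.

End BohlFunctions.

Section Filters.

Lemma within_proper T (F : set_system T) (P : set T) : Filter F ->
  ~ (\forall t \near F, ~ P t) -> ProperFilter (within P F).
Proof. by move=> FF notP; split; [exact: notP|exact: within_filter]. Qed.

Lemma ultra_exists_finite_set T (I : choiceType) (U : set_system T) (D : set I)
    (P : I -> set T) : UltraFilter U -> finite_set D ->
  (\forall t \near U, exists2 i, D i & P i t) ->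
  exists2 i, D i & \forall t \near U, P i t.
Proof.
move=> UU finD UP; apply: contrapT => no_index.
have UnP i : D i -> \forall t \near U, ~ P i t.
  by move=> Di; have [UPi|//] := in_ultra_setVsetC (P i) UU; case: no_index; exists i.
have /finite_fsetP[X DX] := finD; rewrite DX in UP UnP.
have [t [[i Xi Pit] nP]] := filter_ex (filterI UP (@filter_bigI _ _ X _ _ _ UnP)).
exact: nP Pit.
Qed.

Lemma connected_equivalence (T : topologicalType) (E : T -> T -> Prop) :
  connected [set: T] -> (forall x y, E x y -> E y x) ->
  (forall x y z, E x y -> E y z -> E x z) ->
  (forall x, \forall y \near x, E x y) -> forall x y, E x y.
Proof.
move=> connT symE transE near_E x y.
have openEx z : open (E z).
  by rewrite openE => w Ezw; apply: filterS (near_E w) => v; exact: transE.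
suff : E x = [set: T] by move=> ExT; have : [set: T] y by []; rewrite -ExT.
apply: connT.
- by exists x; exact: nbhs_singleton (near_E x).
- by exists (E x); rewrite ?setTI.
- exists (E x); rewrite ?setTI // -openC (_ : ~` E x = \bigcup_(z in ~` E x) E z).
    by apply: bigcup_open => z _; exact: openEx.
  apply/seteqP; split=> [z nExz|w [z nExz Ezw] Exw].
    by exists z => //; exact: nbhs_singleton (near_E z).
  by apply: nExz; apply: transE Exw (symE _ _ Ezw).
Qed.

End Filters.

HB.instance Definition _ (R : realType) p q := Complete.on 'M[R]_(p, q).

Section StrictDifferentiability.
Context {R : realType}.

Lemma is_derive_mx_mvt p q (F dF : R -> 'M[R]_(p, q)) (M : 'M[R]_(p, q)) e : 0 <= e ->
  (forall t : R, is_derive t 1 F (dF t)) ->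
  (forall t, 0 <= t <= 1 -> `|dF t - M| <= e) -> `|F 1 - F 0 - M| <= e.
Proof.
move=> e0 F_dF dF_M; apply/mx_norm_leP => // i j.
have Fij_d (t : R) : is_derive t 1 (fun s => F s i j) (dF t i j).
  by move/is_derive_mxP: (F_dF t).
have Fij_cont : {within `[0, 1], continuous (fun s => F s i j)}.
  apply: continuous_subspaceT => t; apply: differentiable_continuous.
  by apply/derivable1_diffP; have [] := Fij_d t.
have [t] := MVT_segment ler01 (fun t _ => Fij_d t) Fij_cont.
rewrite in_itv /= subr0 mulr1 => t01 FE; rewrite !mxE FE.
by have := mx_entry_norm_le (dF t - M) i j; rewrite !mxE => /le_trans; apply; exact: dF_M.
Qed.

Definition C1_mx n p q (F : 'cV[R]_n -> 'M[R]_(p, q)) (dF : 'I_n -> 'cV[R]_n -> 'M[R]_(p, q)) :=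
  (forall a v (t : R), is_derive t 1 (fun u => F (a + u *: v))
    (\sum_j v j 0 *: dF j (a + t *: v))) /\
  forall j, continuous (dF j).

Lemma C1_mx_linear n p q r s (f : {linear 'M[R]_(p, q) -> 'M[R]_(r, s)})
    (F : 'cV[R]_n -> 'M[R]_(p, q)) dF :
  C1_mx F dF -> C1_mx (f \o F) (fun j => f \o dF j).
Proof.
move=> [F_dF dF_cont]; split=> [a v t|j a].
  apply: is_derive_eq (is_derive_linear f (F_dF a v t)) _.
  by rewrite linear_sum; apply: eq_bigr => j _; rewrite linearZ.
by apply: continuous_comp; [exact: dF_cont|exact: linear_mx_continuous].
Qed.

Lemma C1_mx_strict n p q (F : 'cV[R]_n -> 'M[R]_(p, q)) dF e : C1_mx F dF -> 0 < e ->
  \forall r \near 0^'+, forall a b, `|a| <= r -> `|b| <= r ->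
    `|F a - F b - \sum_j (a - b) j 0 *: dF j 0| <= e * `|a - b|.
Proof.
move=> [F_dF dF_cont] e0; have en : 0 < e / n.+1%:R by rewrite divr_gt0.
have : \forall a \near (0 : 'cV[R]_n), forall j, `|dF j 0 - dF j a| <= e / n.+1%:R.
  apply: (@filter_forall _ _ _ (nbhs (0 : 'cV[R]_n))) => j.
  by have /cvgrPdist_le := dF_cont j 0; apply.
move/nbhsr0P; apply: filterS => r dF_near a b ar br.
have -> : F a = F (b + 1 *: (a - b)) by rewrite scale1r addrC subrK.
have -> : F b = F (b + 0 *: (a - b)) by rewrite scale0r addr0.
apply: (is_derive_mx_mvt (F := fun t => F (b + t *: (a - b))) (dF := fun t =>
  \sum_j (a - b) j 0 *: dF j (b + t *: (a - b)))) => [|t /andP[t0 t1]].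
  by rewrite mulr_ge0 // ltW.
have segment_r : `|0 - (b + t *: (a - b))| <= r.
  rewrite sub0r normrN (_ : b + _ = (1 - t) *: b + t *: a); last first.
    by rewrite scalerBl scale1r scalerBr addrA addrAC.
  apply: le_trans (ler_normD _ _) _; rewrite !normrZ (ger0_norm t0) ger0_norm ?subr_ge0 //.
  have -> : r = (1 - t) * r + t * r by rewrite -mulrDl subrK mul1r.
  by rewrite lerD // ler_wpM2l // subr_ge0.
rewrite -sumrB; apply: le_trans (ler_norm_sum _ _ _) _.
apply: (@le_trans _ _ (\sum_(j < n) `|a - b| * (e / n.+1%:R))).
  apply: ler_sum => j _; rewrite -scalerBr normrZ ler_pM //; first exact: mx_entry_norm_le.
  by rewrite distrC; exact: dF_near.
rewrite sumr_const card_ord -[leLHS]mulr_natr -mulrA mulrC ler_wpM2r //.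
by rewrite mulrAC ler_pdivrMr // ler_pM2l // ler_nat.
Qed.

Lemma C1_mx_lipschitz n p q (F : 'cV[R]_n -> 'M[R]_(p, q)) dF : C1_mx F dF ->
  exists2 C, 0 <= C & \forall r \near 0^'+, forall a b, `|a| <= r -> `|b| <= r ->
    `|F a - F b| <= C * `|a - b|.
Proof.
move=> /C1_mx_strict/(_ ltr01) F_strict.
exists (1 + \sum_j `|dF j 0|) => [|]; first by rewrite addr_ge0 // sumr_ge0.
apply: filterS F_strict => r F_strict a b ar br.
rewrite -(subrK (\sum_j (a - b) j 0 *: dF j 0) (F a - F b)).
apply: le_trans (ler_normD _ _) _; rewrite mulrDl lerD //; first exact: F_strict.
apply: le_trans (ler_norm_sum _ _ _) _; rewrite mulr_suml; apply: ler_sum => j _.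
by rewrite normrZ mulrC ler_wpM2l // mx_entry_norm_le.
Qed.

(* Newton's iteration [a |-> a + (y - f a)] is a contraction. *)
Lemma near_id_surjective (V : completeNormedModType R) (f : V -> V) (r : R) : 0 <= r ->
  (forall a b, `|a| <= r -> `|b| <= r -> `|f a - f b - (a - b)| <= 2^-1 * `|a - b|) ->
  forall y, `|y - f 0| <= r / 2 -> exists2 a, `|a| <= r & f a = y.
Proof.
move=> r0 f_id y y_f0.
pose U := [set a : V | `|a| <= r]; pose T a := a + (y - f a).
have T_lip a b : U a -> U b -> `|T a - T b| <= 2^-1 * `|a - b|.
  move=> Ua Ub; have -> : T a - T b = - (f a - f b - (a - b)).
    rewrite /T opprB opprD addrACA opprB; congr (_ + _).
    by rewrite opprB addrC subrKA.
  by rewrite normrN; exact: f_id.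
have T_U a : U a -> U (T a).
  move=> Ua; have U0 : U 0 by rewrite /U /= normr0.
  rewrite /U /= -(subrK (T 0) (T a)) (le_trans (ler_normD _ _)) //.
  have := T_lip a 0 Ua U0; rewrite (_ : T 0 = y - f 0) ?subr0; last by rewrite /T add0r.
  by have : `|a| <= r := Ua; lra.
pose isFunT := isFun.Build V V U U T T_U.
pose TU : {fun U >-> U} := HB.pack T isFunT.
have [|||a Ua aE] := @banach_fixed_point R V U TU.
- exists (2^-1)%:nng; split; first by rewrite /= invf_lt1 // ltr1n.
  by move=> [a b] [Ua Ub]; exact: T_lip.
- apply: (@preimage_closed _ _ (fun u : V => `|u|) [set x | x <= r]); last exact: closed_le.
  by move=> u _; exact: norm_continuous.
- by exists 0; rewrite /U /= normr0.
exists a => //; apply/esym/eqP; rewrite -subr_eq0; apply/eqP.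
by apply: (@addrI _ a); rewrite addr0 [RHS]aE.
Qed.

Section LocalSurjectivity.
Variables (n k : nat) (H : 'cV[R]_n -> 'M[R]_(n, k)) (dH : 'I_n -> 'cV[R]_n -> 'M[R]_(n, k)).
Variable z0 : 'cV[R]_k.
Hypotheses (C1_H : C1_mx H dH) (dH_z0 : forall j, dH j 0 *m z0 = delta_mx j 0).

Lemma C1_mx_near_id : \forall r \near 0^'+, \forall z \near z0,
  forall a b, `|a| <= r -> `|b| <= r ->
    `|H a *m z - H b *m z - (a - b)| <= 2^-1 * `|a - b|.
Proof.
have [C C0 lip_H] := C1_mx_lipschitz C1_H.
have lt04 : 0 < 4^-1 :> R by rewrite invr_gt0.
have strict_Hz := C1_mx_strict (C1_mx_linear (mulmxr z0) C1_H) lt04.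
have dHz (v : 'cV[R]_n) : \sum_j v j 0 *: (dH j 0 *m z0) = v.
  by rewrite [RHS]matrix_sum_delta; apply: eq_bigr => j _; rewrite big_ord1 dH_z0.
apply: filterS2 lip_H strict_Hz => r lip_H strict_Hz.
have : k%:R * C * `|z - z0| @[z --> z0] --> k%:R * C * `|z0 - z0|.
  apply: (@cvgMl_tmp _ _ (nbhs z0)); apply: (@cvg_norm _ _ _ (nbhs z0)).
  by apply: (@cvgB _ _ _ (nbhs z0)); [exact: cvg_id|exact: cvg_cst].
rewrite subrr normr0 mulr0 => /cvgr_le/(_ _ lt04); apply: filterS => z z_near a b a_r b_r.
rewrite (_ : _ - _ - _ = (H a *m z0 - H b *m z0 - (a - b)) + (H a - H b) *m (z - z0)).
  apply: le_trans (ler_normD _ _) _; rewrite (_ : 2^-1 = 4^-1 + 4^-1); last by field.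
  rewrite mulrDl lerD //; first by have := strict_Hz a b a_r b_r; rewrite /= dHz.
  apply: le_trans (mx_norm_mulmx _ _) _.
  apply: (@le_trans _ _ (k%:R * (C * `|a - b|) * `|z - z0|)).
    by rewrite ler_wpM2r // ler_wpM2l // lip_H.
  by rewrite mulrA mulrAC ler_wpM2r.
by rewrite mulmxBr !mulmxBl [RHS]addrC subrKA.
Qed.

Lemma C1_mx_locally_onto (P : set 'cV[R]_n) : (\forall h \near 0, P h) ->
  \forall z \near z0 & y \near H 0 *m z0, exists2 h, P h & H h *m z = y.
Proof.
move=> near_P.
pose near_id r z := forall a b, `|a| <= r -> `|b| <= r ->
  `|H a *m z - H b *m z - (a - b)| <= 2^-1 * `|a - b|.
near (0 : R)^'+ => r.
have r0 : 0 < r by [].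
have P_r h : `|h| <= r -> P h.
  move: h; near: r; move/nbhsr0P: near_P; apply: filterS => r P_r h h_r.
  by apply: P_r; rewrite sub0r normrN.
have near_z0 : \forall z \near z0, near_id r z by near: r; exact: C1_mx_near_id.
pose G := filter_prod (nbhs z0) (nbhs (H 0 *m z0)).
have near_fst_z0 : \forall zy \near G, near_id r zy.1 by exact: cvg_fst near_z0.
have near_y0 : \forall zy \near G, `|zy.2 - H 0 *m zy.1| <= r / 2.
  have : zy.2 - H 0 *m zy.1 @[zy --> G] --> H 0 *m z0 - H 0 *m z0.
    apply: (@cvgB _ _ _ G); first exact: cvg_snd.
    by apply: (@cvg_mulmx _ _ G); [exact: cvg_cst|exact: cvg_fst].
  by rewrite subrr => /cvgr0_norm_le; apply; rewrite divr_gt0.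
suff : \forall zy \near G, exists2 h, P h & H h *m zy.1 = zy.2 by [].
apply: filterS2 near_fst_z0 near_y0 => -[z y] /= H_near_id y_near.
have [a a_r <-] := near_id_surjective (ltW r0) H_near_id y_near.
by exists a => //; exact: P_r.
Unshelve. all: by end_near. Qed.

End LocalSurjectivity.

End StrictDifferentiability.

Section VectorSpaces.
Context {R : realType}.
Variables (p q : nat) (W : {vspace 'M[R]_(p, q)}).

Lemma vspace_closed : closed [set X | X \in W].
Proof.
rewrite (_ : mkset _ = (fun X => `|(\1%VF - projv W)%VF X|) @^-1` [set 0]).
  apply: preimage_closed; last exact: closed_eq.
  have cont_f : continuous (\1%VF - projv W)%VF by exact: linear_mx_continuous.
  by move=> X _; exact: (cvg_norm (cont_f X)).
apply/seteqP; split=> X /=; rewrite add_lfunE opp_lfunE id_lfunE.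
  by move=> XW; rewrite projv_id // subrr normr0.
by move=> /normr0_eq0/eqP; rewrite subr_eq0 => /eqP ->; exact: memv_proj.
Qed.

Lemma is_derive_vspace (F : R -> 'M[R]_(p, q)) (t : R) dF : is_derive t 1 F dF ->
  F t \in W -> (\forall h \near 0^'+, F (h + t) \in W) -> dF \in W.
Proof.
move=> /is_deriveP /cvg_dnbhs_at_right F_dF Ft Fh.
apply: (closed_cvg _ vspace_closed _ dF F_dF); apply: filterS Fh => h Fh.
by rewrite /= memvZ // memvB // -[h%:A]/(h * 1) mulr1.
Qed.

End VectorSpaces.

Section Words.
Context {R : realType}.
Variables (m : nat) (Om : set 'cV[R]_m).
Implicit Types (s g : seq ('cV[R]_m * R)) (P : set (seq ('cV[R]_m * R))).

Lemma admissible_cat s1 s2 :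
  admissible Om s1 -> admissible Om s2 -> admissible Om (s1 ++ s2).
Proof. by move=> ad1 ad2 p; rewrite mem_cat => /orP[/ad1|/ad2]. Qed.

Lemma admissible_seq1 w t : Om w -> 0 < t -> admissible Om [:: (w, t)].
Proof. by move=> Omw t0 p; rewrite inE => /eqP ->. Qed.

Lemma admissible_cons p s : admissible Om (p :: s) ->
  [/\ Om p.1, 0 < p.2 & admissible Om s].
Proof.
move=> ad; have [Omp p0] := ad p (mem_head _ _).
by split=> // q qs; apply: ad; rewrite inE qs orbT.
Qed.

Lemma total_time_cat s1 s2 : total_time (s1 ++ s2) = total_time s1 + total_time s2.
Proof. exact: big_cat. Qed.

Lemma total_time_seq1 (w : 'cV[R]_m) t : total_time [:: (w, t)] = t.
Proof. exact: big_seq1. Qed.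

Definition short_words : set_system (seq ('cV[R]_m * R)) :=
  filter_from [set e : R | 0 < e] (fun e => [set s | admissible Om s /\ total_time s < e]).

Global Instance short_words_filter : Filter short_words.
Proof.
apply: filter_from_filter; first by exists 1; exact: ltr01.
move=> e f e0 f0; exists (Num.min e f); first by rewrite /= lt_min e0.
by move=> s [ad]; rewrite lt_min => /andP[se sf].
Qed.

Lemma near_short_words_nil P : (\forall s \near short_words, P s) -> P [::].
Proof. by move=> [e e0 Pe]; apply: Pe; split=> //; rewrite /total_time big_nil. Qed.

Lemma near_short_words1 w P : Om w -> (\forall s \near short_words, P s) ->
  \forall t \near 0^'+, P [:: (w, t)].
Proof.
move=> Omw [e e0 Pe]; near=> t; apply: Pe; split; first exact: admissible_seq1.
by rewrite total_time_seq1.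
Unshelve. all: by end_near. Qed.

Lemma near_short_words_cat P : (\forall s \near short_words, P s) ->
  \forall s \near short_words, \forall g \near short_words, P (s ++ g).
Proof.
move=> [e e0 Pe]; have e2 : 0 < e / 2 by rewrite divr_gt0.
exists (e / 2) => // s [ads se]; exists (e / 2) => // g [adg ge].
apply: Pe; split; first exact: admissible_cat.
by rewrite total_time_cat (splitr e) ltrD.
Qed.

End Words.

Section TransitionMatrices.
Context {R : realType}.
Variables (m k : nat) (M : 'cV[R]_m -> 'M[R]_k).
Implicit Types (s : seq ('cV[R]_m * R)) (p : 'cV[R]_m * R) (X : 'M[R]_k).

Definition transition s : 'M[R]_k :=
  foldl (fun g p => expm (p.2 *: M p.1) *m g) 1%:M s.

Lemma transition_rcons s p : transition (rcons s p) = expm (p.2 *: M p.1) *m transition s.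
Proof. by rewrite /transition -cats1 foldl_cat. Qed.

Lemma transition_cat s1 s2 : transition (s1 ++ s2) = transition s2 *m transition s1.
Proof.
elim/last_ind: s2 => [|s2 p IHs]; first by rewrite cats0 mul1mx.
by rewrite -rcons_cat !transition_rcons IHs mulmxA.
Qed.

Lemma transition_cons p s : transition (p :: s) = transition s *m expm (p.2 *: M p.1).
Proof. by rewrite -cat1s transition_cat; congr (_ *m _); rewrite /transition /= mulmx1. Qed.

Lemma transition_unit s : transition s \in unitmx.
Proof.
elim/last_ind: s => [|s p IHs]; first exact: unitmx1.
by rewrite transition_rcons unitmx_mul expm_unit.
Qed.

Lemma mx_norm_transition_sub1 Om K s : (forall w, Om w -> k%:R * `|M w| <= K) ->
  admissible Om s -> k%:R * `|transition s - 1%:M| <= expR (K * total_time s) - 1.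
Proof.
move=> M_K; elim: s => [_|p s IHs /admissible_cons[Omp p0 ads]].
  by rewrite subrr normr0 mulr0 /total_time big_nil mulr0 expR0 subrr.
have {}IHs := IHs ads.
have expm_K : k%:R * `|expm (p.2 *: M p.1) - 1%:M| <= expR (K * p.2) - 1.
  apply: le_trans (mx_norm_expm_sub1 _) _; rewrite lerD2r ler_expR normrZ gtr0_norm //.
  by rewrite mulrCA mulrC ler_wpM2r ?M_K // ltW.
rewrite transition_cons /total_time big_cons -/(total_time s) mulrDr expRD.
set E := expm _ in expm_K *; set T := transition s in IHs *.
have -> : T *m E - 1%:M = (T - 1%:M) *m (E - 1%:M) + (E - 1%:M) + (T - 1%:M).
  by rewrite mulmxBl mul1mx subrK mulmxBr mulmx1 addrA subrK.
apply: (@le_trans _ _ (k%:R * (k%:R * `|T - 1%:M| * `|E - 1%:M| + `|E - 1%:M| + `|T - 1%:M|))).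
  rewrite ler_wpM2l // (le_trans (ler_normD _ _)) // lerD2r.
  by rewrite (le_trans (ler_normD _ _)) // lerD2r mx_norm_mulmx.
have norm_ge0 X : 0 <= k%:R * `|X : 'M[R]_k| by rewrite mulr_ge0.
by have := ler_pM (norm_ge0 _) (norm_ge0 _) expm_K IHs; lra.
Qed.

Lemma transition_short_words Om K : (forall w, Om w -> `|M w| <= K) ->
  transition s @[s --> short_words Om] --> (1%:M : 'M[R]_k).
Proof.
move=> M_K; apply/cvgrPdist_lt => e e0.
pose L := k%:R * `|K|; have L0 : 0 <= L by rewrite mulr_ge0.
have M_L w : Om w -> k%:R * `|M w| <= L.
  by move=> /M_K Mw; rewrite ler_wpM2l // (le_trans Mw) // ler_norm.
have [r [r0 r_e]] : exists r, 0 < r /\ expR (L * r) - 1 < e.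
  have expR_cvg : expR (L * r) @[r --> (0 : R)^'+] --> expR (L * 0).
    apply: cvg_at_right_filter; apply: continuous_comp; last exact: continuous_expR.
    exact: mulrl_continuous.
  have L0e : expR (L * 0) < 1 + e by rewrite mulr0 expR0 ltrDl.
  near (0 : R)^'+ => r; exists r; split=> //.
  by rewrite ltrBlDl; near: r; exact: (cvgr_lt _ expR_cvg).
exists r => // s [ads sr]; rewrite distrC; apply: le_lt_trans r_e.
apply: le_trans (_ : expR (L * total_time s) - 1 <= _); last first.
  by rewrite lerD2r ler_expR ler_wpM2l // ltW.
apply: le_trans (mx_norm_transition_sub1 M_L ads).
case: k (transition s - 1%:M) => [|k'] X; first by rewrite [X]flatmx0 normr0 mulr0.
by rewrite ler_peMl // ler1n.
Unshelve. all: by end_near. Qed.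

Lemma conjmx_is_linear (g : 'M[R]_k) : linear (conjmx g : 'M[R]_k -> 'M[R]_k).
Proof. by move=> c X Y; rewrite /conjmx mulmxDr mulmxDl -scalemxAr -scalemxAl. Qed.

HB.instance Definition _ (g : 'M[R]_k) :=
  GRing.isLinear.Build _ _ _ _ (conjmx g : 'M[R]_k -> 'M[R]_k) (conjmx_is_linear g).

Lemma mulmx_conjV (g X : 'M[R]_k) : g \in unitmx -> g *m conjmx (invmx g) X = X *m g.
Proof. by move=> ug; rewrite conjVmx // -mulmxA mulKVmx. Qed.

Lemma conjVmxM (g h X : 'M[R]_k) : g \in unitmx -> h \in unitmx ->
  conjmx (invmx (g *m h)) X = conjmx (invmx h) (conjmx (invmx g) X).
Proof.
move=> ug uh; have ugh : g *m h \in unitmx by rewrite unitmx_mul ug.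
apply: (can_inj (mulKmx ugh)); rewrite mulmx_conjV // -mulmxA mulmx_conjV //.
by rewrite [RHS]mulmxA mulmx_conjV // mulmxA.
Qed.

(* The partial derivative of [transition s] in the i-th duration is
   [transition s] times the i-th entry. *)
Fixpoint duration_dirs s : seq 'M[R]_k :=
  if s is p :: s' then
    M p.1 :: map (conjmx (invmx (expm (p.2 *: M p.1)))) (duration_dirs s')
  else [::].

Lemma size_duration_dirs s : size (duration_dirs s) = size s.
Proof. by elim: s => //= p s <-; rewrite size_map. Qed.

Lemma duration_dirs_cat s1 s2 : duration_dirs (s1 ++ s2) =
  duration_dirs s1 ++ map (conjmx (invmx (transition s1))) (duration_dirs s2).
Proof.
elim: s1 => [|p s1 IHs] /=.
  by rewrite -[LHS]map_id; apply: eq_map => X; rewrite invmx1 conj1mx.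
rewrite IHs map_cat -map_comp; congr (_ :: _ ++ _); apply: eq_map => X /=.
by rewrite transition_cons conjVmxM ?transition_unit ?expm_unit.
Qed.

Section LieAlgebraSpan.
Variable Om : set 'cV[R]_m.

Definition spanning_word s := forall Z, liealg [set M w | w in Om] Z ->
  conjmx (invmx (transition s)) Z \in <<duration_dirs s>>%VS.

Section AdjointInvariance.
Variables (s0 : seq ('cV[R]_m * R)) (W : {vspace 'M[R]_k}).

Definition shortly_in X :=
  \forall g \near short_words Om, conjmx (invmx (transition (s0 ++ g))) X \in W.

Lemma shortly_in_linear c X Y : shortly_in X -> shortly_in Y -> shortly_in (c *: X + Y).
Proof.
by apply: filterS2 => g XW YW; rewrite linearP /= memvD // memvZ.
Qed.

(* Ad-invariance along [exp(h M w)], differentiated at [h = 0]. *)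
Lemma shortly_in_bracket w X : Om w -> shortly_in X ->
  shortly_in (M w *m X - X *m M w).
Proof.
move=> Omw XW; apply: filterS2 (XW) (near_short_words_cat XW) => g gW ghW.
pose F (h : R) := conjmx (invmx (transition (s0 ++ g))) (expm (- h *: M w) *m X *m expm (h *: M w)).
have F_d : is_derive (0 : R) 1 F (conjmx (invmx (transition (s0 ++ g))) (- (M w *m X - X *m M w))).
  apply: (is_derive_linear (conjmx (invmx _))).
  have d_inv := is_derive_expm_comp (M w) (is_deriveNid (0 : R) 1).
  apply: is_derive_eq (is_derive_mulmx (is_derive_mulmx d_inv (is_derive_cst X _ _))
    (is_derive_expm (M w) 0)) _.
  rewrite oppr0 scale0r expm0 mulmx0 addr0 !mulmx1 !mul1mx scaleN1r mulNmx.
  by rewrite opprB addrC.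
rewrite -memvN -linearN; apply: (is_derive_vspace F_d).
  by rewrite /F oppr0 scale0r expm0 mul1mx mulmx1.
have := near_short_words1 Omw ghW; apply: filterS => h.
rewrite addr0 /F catA transition_cat conjVmxM ?transition_unit //.
by rewrite /transition /= mulmx1 [conjmx _ X]conjVmx ?expm_unit // invmx_expm.
Qed.

Lemma shortly_in_liealg Z : (forall w, Om w -> shortly_in (M w)) ->
  liealg [set M w | w in Om] Z -> shortly_in Z.
Proof.
move=> genW.
have in0 : shortly_in 0 by apply: nearW => g; rewrite linear0 mem0v.
have inD X Y : shortly_in X -> shortly_in Y -> shortly_in (X + Y).
  by move=> XW YW; rewrite -[X]scale1r; exact: shortly_in_linear.
have inZ c X : shortly_in X -> shortly_in (c *: X).
  by move=> XW; rewrite -[_ *: _]addr0; exact: shortly_in_linear.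
have inB X Y : shortly_in X -> shortly_in Y -> shortly_in (X - Y).
  by move=> XW /(inZ (-1)); rewrite scaleN1r; exact: inD.
have bracket Z' : liealg [set M w | w in Om] Z' ->
    forall X, shortly_in X -> shortly_in (Z' *m X - X *m Z').
  elim=> {Z'} [_ [w Omw <-]||Z1 Z2 _ br1 _ br2|c Z' _ br|Z1 Z2 _ br1 _ br2] X XW.
  - exact: shortly_in_bracket.
  - by rewrite mul0mx mulmx0 subr0.
  - by rewrite mulmxDl mulmxDr opprD addrACA; apply: inD; [exact: br1|exact: br2].
  - by rewrite -scalemxAl -scalemxAr -scalerBr; exact/inZ/br.
  - rewrite (_ : _ - _ = Z1 *m (Z2 *m X - X *m Z2) - (Z2 *m X - X *m Z2) *m Z1 -
      (Z2 *m (Z1 *m X - X *m Z1) - (Z1 *m X - X *m Z1) *m Z2)); last first.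
      rewrite !(mulmxBl, mulmxBr) !mulmxA !opprB.
      by apply/matrixP => i j; rewrite !mxE; ring.
    by apply: inB; [exact/br1/br2|exact/br2/br1].
elim=> {Z} [_ [w Omw <-]||Z1 Z2 _ in1 _ in2|c Z _ ZW|Z1 Z2 L1 _ _ in2] //.
- exact: genW.
- exact: inD.
- exact: inZ.
- exact: bracket.
Qed.

End AdjointInvariance.

(* Krener's argument: a word whose span of partial derivatives has maximal
   dimension among the short words is not improved by short extensions. *)
Lemma spanning_word_exists w0 (P : set (seq ('cV[R]_m * R))) : Om w0 ->
  (\forall s \near short_words Om, P s) ->
  exists s, [/\ s != [::], admissible Om s, P s & spanning_word s].
Proof.
move=> Om_w0 [e /= e0 Pe].
pose attained (r : nat) := `[< exists s, [/\ s != [::], admissible Om s, total_time s < e &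
  \dim <<duration_dirs s>>%VS = r] >].
have attained_ex : exists r, attained r.
  exists (\dim <<duration_dirs [:: (w0, e / 2)]>>%VS); apply/asboolP; exists [:: (w0, e / 2)].
  split=> //; first by apply: admissible_seq1 => //; rewrite divr_gt0.
  by rewrite total_time_seq1; lra.
have attained_ub r : attained r -> (r <= \dim (fullv : {vspace 'M[R]_k}))%N.
  by move=> /asboolP[s [_ _ _ <-]]; exact/dimvS/subvf.
case: (ex_maxnP attained_ex attained_ub) => r /asboolP[s [s0 ads se dim_s]] r_max.
exists s; split=> [//|//||Z LZ]; first exact: Pe.
have genW w : Om w -> shortly_in s <<duration_dirs s>>%VS (M w).
  move=> Omw; exists (e - total_time s) => [|g [adg ge]]; first by rewrite /= subr_gt0.
  pose tau := (e - total_time s - total_time g) / 2.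
  have tau0 : 0 < tau by rewrite /tau; lra.
  pose s' := s ++ g ++ [:: (w, tau)].
  have dirs_sub : (<<duration_dirs s>> <= <<duration_dirs s'>>)%VS.
    by rewrite /s' duration_dirs_cat span_cat addvSl.
  have attained_s' : attained (\dim <<duration_dirs s'>>%VS).
    apply/asboolP; exists s'; split=> //.
    - by rewrite /s'; case: (s) s0.
    - by do 2 apply: admissible_cat => //; exact: admissible_seq1.
    - by rewrite !total_time_cat total_time_seq1 /tau; lra.
  have /eqP -> : <<duration_dirs s>>%VS == <<duration_dirs s'>>%VS.
    by rewrite -(geq_leqif (dimv_leqif_eq dirs_sub)) dim_s r_max.
  rewrite /s' catA duration_dirs_cat span_cat; apply: (subvP (addvSr _ _)).
  exact: memv_span (mem_head _ _).
by have := near_short_words_nil (shortly_in_liealg genW LZ); rewrite cats0.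
Qed.

End LieAlgebraSpan.

End TransitionMatrices.

Section LocalControllability.
Context {R : realType}.
Variables (m k n : nat) (M : 'cV[R]_m -> 'M[R]_k) (Om : set 'cV[R]_m).
Implicit Types (s : seq ('cV[R]_m * R)) (ss : seq (('cV[R]_m * R) * 'rV[R]_n)).

Definition perturbed_duration (q : ('cV[R]_m * R) * 'rV[R]_n) (h : 'cV[R]_n) : R :=
  q.1.2 + (q.2 *m h) 0 0.

Definition perturb ss h : seq ('cV[R]_m * R) :=
  [seq (q.1.1, perturbed_duration q h) | q <- ss].

Lemma perturb0 ss : perturb ss 0 = map fst ss.
Proof.
by apply: eq_map => -[[w t] l]; rewrite /perturbed_duration /= mulmx0 mxE addr0.
Qed.

Section Convergence.
Context {T : Type} {F : set_system T} {FF : Filter F}.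
Variables (f : T -> 'cV[R]_n) (h : 'cV[R]_n).
Hypothesis f_h : f @ F --> h.

Lemma cvg_perturbed_duration q :
  perturbed_duration q (f x) @[x --> F] --> perturbed_duration q h.
Proof.
have cvg_lf : q.2 *m f x @[x --> F] --> q.2 *m h by apply: cvg_mulmx f_h; exact: cvg_cst.
by apply: cvgD; [exact: cvg_cst|move/cvg_mxP: cvg_lf; apply].
Qed.

Lemma cvg_transition_perturb ss :
  transition M (perturb ss (f x)) @[x --> F] --> transition M (perturb ss h).
Proof.
elim: ss => [|q ss IHss]; first exact: cvg_cst.
under eq_cvg do rewrite /= transition_cons /=.
rewrite /= transition_cons /=; apply: cvg_mulmx => //.
by apply: cvg_expm; exact: cvg_perturbed_duration.
Qed.

Lemma cvg_duration_dirs_perturb ss i :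
  (duration_dirs M (perturb ss (f x)))`_i @[x --> F] --> (duration_dirs M (perturb ss h))`_i.
Proof.
elim: ss i => [|q ss IHss] [|i] /=; try exact: cvg_cst.
have [i_ss|ss_i] := ltnP i (size ss); last first.
  apply: cvg_near_cst; apply: nearW => x.
  by rewrite !nth_default // size_map size_duration_dirs size_map.
have nthE x : (map (conjmx (invmx (expm (perturbed_duration q x *: M q.1.1))))
    (duration_dirs M (perturb ss x)))`_i = expm (- perturbed_duration q x *: M q.1.1) *m
    (duration_dirs M (perturb ss x))`_i *m expm (perturbed_duration q x *: M q.1.1).
  by rewrite (nth_map 0) ?size_duration_dirs ?size_map // conjVmx ?expm_unit // invmx_expm.
under eq_cvg do rewrite nthE; rewrite nthE.
have cvg_dur := @cvg_perturbed_duration q.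
apply: cvg_mulmx; last exact: cvg_expm.
by apply: cvg_mulmx => //; apply: cvg_expm; exact: cvgN.
Qed.

Lemma near_perturb_admissible ss : h = 0 -> admissible Om (map fst ss) ->
  \forall x \near F, admissible Om (perturb ss (f x)).
Proof.
move=> h0; elim: ss => [|q ss IHss]; first by move=> _; apply: nearW.
move=> /admissible_cons[/= Omq q0 /IHss near_ss].
have near_q : \forall x \near F, 0 < perturbed_duration q (f x).
  apply: (cvgr_gt _ (@cvg_perturbed_duration q)).
  by rewrite h0 /perturbed_duration mulmx0 mxE addr0.
apply: filterS2 near_q near_ss => x q_x ss_x p; rewrite inE => /orP[/eqP -> //|].
exact: ss_x.
Qed.

End Convergence.

Lemma is_derive_perturbed_duration q a v (t : R) :
  is_derive t 1 (fun u => perturbed_duration q (a + u *: v)) ((q.2 *m v) 0 0).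
Proof.
rewrite (_ : (fun u => _) = fun u => perturbed_duration q a + u * (q.2 *m v) 0 0).
  exact: is_derive1_affine.
by apply/funext => u; rewrite /perturbed_duration mulmxDr -scalemxAr !mxE addrA.
Qed.

Lemma is_derive_transition_perturb ss a v (t : R) :
  is_derive t 1 (fun u => transition M (perturb ss (a + u *: v)))
    (transition M (perturb ss (a + t *: v)) *m \sum_(i < size ss)
      (nth 0 (map snd ss) i *m v) 0 0 *: (duration_dirs M (perturb ss (a + t *: v)))`_i).
Proof.
elim: ss => [|q ss IHss].
  rewrite big_ord0 mulmx0; exact: is_derive_cst.
under eq_fun do rewrite /= transition_cons /=.
apply: is_derive_eq (is_derive_mulmx IHss
  (is_derive_expm_comp (M q.1.1) (is_derive_perturbed_duration q a v t))) _.
rewrite big_ord_recl /= transition_cons /=; set E := expm _; set T := transition _ _.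
have uE : E \in unitmx by exact: expm_unit.
rewrite mulmxDr addrC; congr (_ + _).
  by rewrite -!scalemxAr -mulmxA expmZ_commute.
rewrite -!mulmxA; congr (_ *m _); rewrite mulmx_suml mulmx_sumr; apply: eq_bigr => i _.
rewrite -scalemxAl -scalemxAr; congr (_ *: _).
by rewrite add0n (nth_map 0) ?size_duration_dirs ?size_map ?mulmx_conjV.
Qed.

Definition perturb_partial ss j h : 'M[R]_k := transition M (perturb ss h) *m
  \sum_(i < size ss) (nth 0 (map snd ss) i) 0 j *: (duration_dirs M (perturb ss h))`_i.

Lemma cvg_perturb_partial T (F : set_system T) {FF : Filter F} (f : T -> 'cV[R]_n) h ss j :
  f @ F --> h -> perturb_partial ss j (f x) @[x --> F] --> perturb_partial ss j h.
Proof.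
move=> f_h; apply: cvg_mulmx; first exact: cvg_transition_perturb.
apply: cvg_big => [|i _]; first exact: add_continuous.
by apply: cvgZl_tmp; exact: cvg_duration_dirs_perturb.
Qed.

Lemma transition_perturb_C1 ss :
  C1_mx (fun h => transition M (perturb ss h)) (perturb_partial ss).
Proof.
split=> [a v t|j h].
  apply: is_derive_eq (is_derive_transition_perturb ss a v t) _.
  under [in RHS]eq_bigr do rewrite scalemxAr scaler_sumr.
  rewrite -mulmx_sumr exchange_big; congr (_ *m _); apply: eq_bigr => i _ /=.
  rewrite mxE scaler_suml; apply: eq_bigr => j _.
  by rewrite scalerA mulrC.
apply: (@cvg_perturb_partial _ (nbhs h)); exact: cvg_id.
Qed.

Lemma spanning_word_deformation s (Z : 'I_n -> 'M[R]_k) :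
  admissible Om s -> spanning_word M Om s ->
  (forall j, liealg [set M w | w in Om] (Z j)) ->
  exists (D : 'cV[R]_n -> seq ('cV[R]_m * R)) dT, [/\ D 0 = s,
    \forall h \near (0 : 'cV[R]_n), admissible Om (D h), C1_mx (fun h => transition M (D h)) dT &
    forall j, dT j 0 = Z j *m transition M s].
Proof.
move=> ads span_s LZ.
pose c j i := coord (in_tuple (duration_dirs M s)) i (conjmx (invmx (transition M s)) (Z j)).
have cE j : conjmx (invmx (transition M s)) (Z j) = \sum_i c j i *: (duration_dirs M s)`_i.
  exact: (@coord_span _ _ _ (in_tuple (duration_dirs M s)) _ (span_s _ (LZ j))).
pose ls := [seq (\row_j c j i) | i : 'I_(size (duration_dirs M s))].
have size_ls : size ls = size s by rewrite size_map size_enum_ord size_duration_dirs.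
pose ss := zip s ls.
have ssE : map fst ss = s by rewrite -[RHS](@unzip1_zip _ _ s ls) ?size_ls.
have snd_ssE : map snd ss = ls by rewrite -[RHS](@unzip2_zip _ _ s ls) ?size_ls.
exists (perturb ss), (perturb_partial ss); split.
- by rewrite perturb0.
- by apply: (@near_perturb_admissible _ (nbhs (0 : 'cV[R]_n)) _ id 0); rewrite ?ssE.
- exact: transition_perturb_C1.
move=> j; rewrite /perturb_partial perturb0 ssE snd_ssE.
rewrite -(mulmx_conjV _ (transition_unit M s)) cE; congr (_ *m _).
rewrite size_zip size_ls minnn -(size_duration_dirs M s); apply: eq_bigr => i _.
by rewrite /ls (nth_map i) ?size_enum_ord // nth_ord_enum mxE.
Qed.

Lemma near_reachable s (z0 : 'cV[R]_k) (Pr : 'M[R]_(n, k)) :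
  admissible Om s -> spanning_word M Om s ->
  (forall y : 'cV[R]_n, exists2 Z, liealg [set M w | w in Om] Z &
     Pr *m (Z *m (transition M s *m z0)) = y) ->
  \forall z \near z0 & y \near Pr *m (transition M s *m z0),
    exists2 s', admissible Om s' & Pr *m (transition M s' *m z) = y.
Proof.
move=> ads span_s onto.
have /choice[Z /all_and2[LZ PrZ]] : forall j : 'I_n, exists Z,
    liealg [set M w | w in Om] Z /\ Pr *m (Z *m (transition M s *m z0)) = delta_mx j 0.
  by move=> j; have [Z LZ ZE] := onto (delta_mx j 0); exists Z.
have [D [dT [D0 adD C1_D dT0]]] := spanning_word_deformation ads span_s LZ.
have C1_H := C1_mx_linear (mulmx Pr) C1_D.
have dH_z0 j : (mulmx Pr \o dT j) 0 *m z0 = delta_mx j 0 by rewrite /= dT0 -!mulmxA.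
have := C1_mx_locally_onto C1_H dH_z0 adD; rewrite /= D0 -mulmxA.
by apply: filterS => -[z y] /= [h adDh hE]; exists (D h); rewrite ?mulmxA.
Qed.

End LocalControllability.

Section ControlSystems.
Context {R : realType}.
Variables (m k : nat) (F : 'cV[R]_m -> R -> 'cV[R]_k -> 'cV[R]_k) (Om : set 'cV[R]_m).
Implicit Types (x y z : 'cV[R]_k) (s : seq ('cV[R]_m * R)) (X D : set 'cV[R]_k).

Record is_flow : Prop := IsFlow {
  flow0 : forall w x, F w 0 x = x;
  flowD : forall w a b x, F w b (F w a x) = F w (a + b) x;
  flow_continuous : forall w t, continuous (F w t) }.

Hypothesis flowF : is_flow.

Lemma run_cat s1 s2 x : run F (s1 ++ s2) x = run F s2 (run F s1 x).
Proof. exact: foldl_cat. Qed.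

Lemma run_continuous s : continuous (run F s).
Proof.
elim: s => [|p s IHs] x; first exact: cvg_id.
by apply: (@continuous_comp _ _ _ (F p.1 p.2) (run F s)); [exact: flow_continuous|exact: IHs].
Qed.

Definition reverse_word s := rev [seq (p.1, - p.2) | p <- s].

Lemma reverse_word_cons p s : reverse_word (p :: s) = reverse_word s ++ [:: (p.1, - p.2)].
Proof. by rewrite /reverse_word /= rev_cons -cats1. Qed.

Lemma run_reverseK s : cancel (run F (reverse_word s)) (run F s).
Proof.
elim: s => [|p s IHs] x //.
by rewrite reverse_word_cons run_cat /= flowD // addNr flow0 // IHs.
Qed.

Lemma reverse_runK s : cancel (run F s) (run F (reverse_word s)).
Proof.
elim: s => [|p s IHs] x //.
by rewrite reverse_word_cons run_cat [X in run F _ X]IHs /= flowD // addrN flow0.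
Qed.

Lemma orbit_refl x : orbit_pos F Om x x.
Proof. by exists [::]. Qed.

Lemma orbit_trans y x z : orbit_pos F Om x y -> orbit_pos F Om y z -> orbit_pos F Om x z.
Proof.
move=> [s1 [s1_pos ->]] [s2 [s2_pos ->]]; exists (s1 ++ s2); split; last by rewrite run_cat.
by move=> p; rewrite mem_cat => /orP[/s1_pos|/s2_pos].
Qed.

Lemma orbit_run s x : admissible Om s -> orbit_pos F Om x (run F s x).
Proof. by move=> ads; exists s; split=> // p /ads[? /ltW]. Qed.

Lemma orbit_admissible x y : orbit_pos F Om x y ->
  exists2 s, admissible Om s & y = run F s x.
Proof.
move=> [s [s_pos ->]]; exists [seq p <- s | 0 < p.2].
  by move=> p; rewrite mem_filter => /andP[p0 /s_pos[]].
elim: s x s_pos => [//|p s IHs] x s_pos.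
have [_ p0] := s_pos p (mem_head _ _).
have tail_pos q : q \in s -> Om q.1 /\ 0 <= q.2.
  by move=> qs; apply: s_pos; rewrite inE qs orbT.
rewrite /=; case: ifPn => [_|]; first exact: IHs.
rewrite -leNgt => p_le0; have -> : p.2 = 0 by apply/eqP; rewrite eq_le p0 p_le0.
by rewrite flow0 //; exact: IHs.
Qed.

Lemma closure_orbit_trans y x z : closure (orbit_pos F Om x) y ->
  closure (orbit_pos F Om y) z -> closure (orbit_pos F Om x) z.
Proof.
move=> xy yz V /nbhs_interior nVz; have [_ [[s [s_pos ->]] Vy]] := yz _ nVz.
have [x' [xx' Vx']] := xy _ (@run_continuous s y _ Vy).
by exists (run F s x'); split=> //; apply: orbit_trans xx' _; exists s.
Qed.

Definition mutually_reachable y : set 'cV[R]_k :=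
  [set z | orbit_pos F Om y z /\ orbit_pos F Om z y].

Lemma mutually_reachable_refl y : mutually_reachable y y.
Proof. by split; exact: orbit_refl. Qed.

Lemma mutually_reachable_sym x y : mutually_reachable x y -> mutually_reachable y x.
Proof. by case. Qed.

Lemma mutually_reachable_trans x y z :
  mutually_reachable x y -> mutually_reachable y z -> mutually_reachable x z.
Proof.
by move=> [xy yx] [yz zy]; split; [exact: orbit_trans xy yz|exact: orbit_trans zy yx].
Qed.

Definition locally_reachable x y :=
  \forall x' \near x & y' \near y, orbit_pos F Om x' y'.

Lemma locally_reachable_extend pre post x y : admissible Om pre -> admissible Om post ->
  locally_reachable (run F pre x) y -> locally_reachable x (run F post y).
Proof.
move=> ad_pre ad_post [[A B] [/= nA nB] AB].
exists (run F pre @^-1` A, run F (reverse_word post) @^-1` B).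
  split; first exact: run_continuous nA.
  by apply: run_continuous; rewrite reverse_runK.
move=> [x' y'] [/= Ax' By']; apply: orbit_trans (orbit_run x' ad_pre) _.
apply: (orbit_trans (y := run F (reverse_word post) y')); first exact: (AB (_, _)).
by rewrite -{2}(run_reverseK post y'); exact: orbit_run.
Qed.

Lemma locally_reachable_closure x y z : closure (orbit_pos F Om x) y ->
  locally_reachable y z -> orbit_pos F Om x z.
Proof.
move=> xy [[A B] [/= nA nB] AB]; have [y' [xy' Ay']] := xy _ nA.
apply: orbit_trans xy' _; apply: (AB (_, _)); split=> //=; exact: nbhs_singleton.
Qed.

Lemma locally_reachable_mutually y : locally_reachable y y ->
  \forall z \near y, mutually_reachable y z.
Proof.
move=> [[A B] [/= nA nB] AB].
have [Ay By] : A y /\ B y by split; exact: nbhs_singleton.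
by apply: filterS2 nA nB => z Az Bz; split; exact: (AB (_, _)).
Qed.

Lemma locally_reachable_line y (v : 'cV[R]_k) :
  (forall c, locally_reachable (y + c *: v) (y + c *: v)) ->
  forall c, mutually_reachable y (y + c *: v).
Proof.
move=> loc c; rewrite -{1}[y]addr0 -(scale0r v).
apply: (@connected_equivalence R
  (fun a b => mutually_reachable (y + a *: v) (y + b *: v))) => [||p q r|a].
- by apply/connected_intervalP => ? ? _ _ ?.
- by move=> a b; exact: mutually_reachable_sym.
- exact: mutually_reachable_trans.
have cvg_line : y + b *: v @[b --> a] --> y + a *: v.
  by apply: cvgD; [exact: cvg_cst|apply: cvgZr_tmp; exact: cvg_id].
exact: cvg_line (locally_reachable_mutually (loc a)).
Qed.

Section PeriodicControl.
Variables (s : seq ('cV[R]_m * R)) (z : 'cV[R]_k).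
Hypotheses (s_neq0 : s != [::]) (ad_s : admissible Om s) (loop : run F s z = z).

Let piece j := nth (0, 0) s (j %% size s).
Let control j := (piece j).1.
Let duration j := (piece j).2.

Let size_s_gt0 : (0 < size s)%N.
Proof. by case: (s) s_neq0. Qed.

Let piece_mem j : piece j \in s.
Proof. by rewrite mem_nth // ltn_pmod. Qed.

Lemma run_takeS i : (i < size s)%N -> run F (take i.+1 s) z =
  F (nth (0, 0) s i).1 (nth (0, 0) s i).2 (run F (take i s) z).
Proof. by move=> i_s; rewrite (take_nth (0, 0)) // -cats1 run_cat. Qed.

Lemma stateN_periodic j : stateN F control duration z j = run F (take (j %% size s) s) z.
Proof.
elim: j => [|j IHj]; first by rewrite mod0n take0.
rewrite /= IHj -run_takeS ?ltn_pmod // -[j.+1]addn1 -modnDml addn1.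
have := ltn_pmod j size_s_gt0; rewrite leq_eqVlt => /orP[/eqP ->|j_lt].
  by rewrite modnn take0 take_size.
by rewrite (modn_small j_lt).
Qed.

Lemma periodic_duration_unbounded (T : R) : exists N, T <= \sum_(j < N) duration j.
Proof.
have [c c0 c_le] : exists2 c, 0 < c & forall p, p \in s -> c <= p.2.
  elim: (s) ad_s => [|p s' IHs] ad; first by exists 1.
  have [_ p0 ad'] := admissible_cons ad; have [c c0 c_le] := IHs ad'.
  exists (Num.min c p.2) => [|q]; first by rewrite lt_min c0.
  by rewrite inE => /orP[/eqP ->|/c_le qc]; rewrite ge_min ?lexx ?orbT // qc.
exists (Num.truncn `|T / c|).+1.
apply: (@le_trans _ _ (\sum_(j < (Num.truncn `|T / c|).+1) c)).
  rewrite sumr_const card_ord -[leRHS]mulr_natl -ler_pdivrMr //.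
  by apply: le_trans (ler_norm _) _; rewrite ltW // truncnS_gt.
by apply: ler_sum => j _; exact: c_le.
Qed.

Lemma loop_can_stay D : mutually_reachable z `<=` D -> can_stay F Om D z.
Proof.
move=> zD; have pos p : p \in s -> Om p.1 /\ 0 <= p.2 by move=> /ad_s[? /ltW].
exists control, duration; split.
- by move=> j; have [] := ad_s (piece_mem j).
- by move=> j; have [] := ad_s (piece_mem j).
- exact: periodic_duration_unbounded.
move=> j u /andP[u0 u_le]; apply: zD; rewrite stateN_periodic; set i := (j %% size s)%N.
have i_s : (i < size s)%N by exact: ltn_pmod.
have [Omj _] := pos _ (piece_mem j); split.
  exists (take i s ++ [:: (control j, u)]); split; last by rewrite run_cat.
  by move=> p; rewrite mem_cat inE => /orP[/mem_take/pos//|/eqP ->].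
exists ((control j, duration j - u) :: drop i.+1 s); split.
  move=> p; rewrite inE => /orP[/eqP ->|/mem_drop/pos//].
  by split=> //=; rewrite subr_ge0.
rewrite /= -[run F _ _]/(run F (drop i.+1 s) _) flowD //.
by rewrite addrC subrK -run_takeS // -run_cat cat_take_drop loop.
Qed.

End PeriodicControl.

Lemma mutually_reachable_ctrl_pre X s y : s != [::] -> admissible Om s -> run F s y = y ->
  (forall z, orbit_pos F Om y z -> X z) -> ctrl_pre F Om X (mutually_reachable y).
Proof.
move=> s0 ad_s loop orbX; split.
- by move=> z [/orbX].
- by exists y; exact: mutually_reachable_refl.
- move=> z yz; have [/orbit_admissible[b ad_b zE] /orbit_admissible[a ad_a yE]] := yz.
  apply: (@loop_can_stay (a ++ s ++ b)).
  + by case: (a) => //; case: (s) s0.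
  + by do 2 apply: admissible_cat => //.
  + by rewrite !run_cat -yE loop.
  + by move=> z'; exact: mutually_reachable_trans.
- move=> z [_ zy] z' [yz' _]; rewrite closureRE; apply: subset_closure.
  exact: orbit_trans zy yz'.
Qed.

Lemma bigcup_ctrl_pre X y (Ds : set (set 'cV[R]_k)) : Ds !=set0 ->
  (forall D, Ds D -> ctrl_pre F Om X D /\ D y) ->
  ctrl_pre F Om X (\bigcup_(D in Ds) D).
Proof.
move=> [D0 Ds0] preDs; split.
- by move=> z [D DsD Dz]; have [[DX _ _ _] _] := preDs _ DsD; exact: DX.
- by exists y; exists D0 => //; have [] := preDs _ Ds0.
- move=> z [D DsD Dz]; have [[_ _ stayD _] _] := preDs _ DsD.
  have [w [tau [Omw tau0 tauT inD]]] := stayD z Dz.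
  by exists w, tau; split=> // j u uj; exists D => //; exact: inD.
- move=> z [D DsD Dz] z' [D' DsD' Dz']; rewrite closureRE.
  have [[_ _ _ clD] Dy] := preDs _ DsD; have [[_ _ _ clD'] Dy'] := preDs _ DsD'.
  apply: (@closure_orbit_trans y); rewrite -closureRE; first exact: clD.
  exact: clD'.
Qed.

Lemma control_set_exists X D0 y : ctrl_pre F Om X D0 -> D0 y ->
  exists2 D, control_set F Om X D & D0 `<=` D.
Proof.
move=> preD0 D0y; pose Ds := [set D | ctrl_pre F Om X D /\ D y].
exists (\bigcup_(D in Ds) D); last by move=> z D0z; exists D0.
split; first by apply: (@bigcup_ctrl_pre X y Ds); [exists D0|move=> D].
move=> D' preD' sub; apply/seteqP; split=> // z D'z; exists D' => //; split=> //.
by apply: sub; exists D0.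
Qed.

Lemma control_set_absorbs X D0 D y : control_set F Om X D -> D y ->
  ctrl_pre F Om X D0 -> D0 y -> D0 `<=` D.
Proof.
move=> [preD maxD] Dy preD0 D0y.
have preU : ctrl_pre F Om X (\bigcup_(E in [set D; D0]) E).
  by apply: (@bigcup_ctrl_pre _ y); [exists D; left|move=> E [->|->]].
rewrite -[X in _ `<=` X](maxD _ preU).
  by move=> z D0z; exists D0 => //; right.
by move=> z Dz; exists D => //; left.
Qed.

Lemma control_set_of_loop X s y : s != [::] -> admissible Om s -> run F s y = y ->
  (forall z, orbit_pos F Om y z -> X z) -> locally_reachable y y ->
  exists D, [/\ control_set F Om X D, has_interior D & mutually_reachable y `<=` D].
Proof.
move=> s0 ad_s loop orbX loc_y.
have pre := mutually_reachable_ctrl_pre s0 ad_s loop orbX.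
have [D cD sub] := control_set_exists pre (mutually_reachable_refl y).
exists D; split=> //; apply/has_interiorP; exists y.
exact: filterS sub (locally_reachable_mutually loc_y).
Qed.

End ControlSystems.

Section AffineSystems.
Context {R : realType}.
Variables (n m : nat).
Variables (A : 'M[R]_n) (B : 'I_m -> 'M[R]_n) (C : 'M[R]_(n, m)) (d : 'cV[R]_n).
Variable Om : set 'cV[R]_m.
Implicit Types (s : seq ('cV[R]_m * R)) (w : 'cV[R]_m) (x y z : 'cV[R]_n).

Local Notation Au := (Au A B).
Local Notation Mhat := (Mhat A B C d).
Local Notation Fhom := (Fhom A B).
Local Notation Faff := (Faff A B C d).
Local Notation Phi := (Phi A B).
Local Notation gel := (gel A B C d).

Lemma expm_block (a : 'M[R]_n) (b : 'M[R]_(n, 1)) (t : R) :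
  exists b', expm (t *: (block_mx a b 0 0 : 'M[R]_(n + 1))) =
    block_mx (expm (t *: a)) b' 0 1%:M.
Proof.
pose E (u : R) := expm (u *: (block_mx a b 0 0 : 'M[R]_(n + 1))).
have E_sol (u : R) : is_derive u 1 E (block_mx a b 0 0 *m E u) by exact: is_derive_expm.
have mulE u : (block_mx a b 0 0 : 'M[R]_(n + 1)) *m E u =
    block_mx (a *m ulsubmx (E u) + b *m dlsubmx (E u))
      (a *m ursubmx (E u) + b *m drsubmx (E u)) 0 0.
  by rewrite -{1}(submxK (E u)) mulmx_block !mul0mx !addr0.
have E0 : E 0 = block_mx 1%:M 0 0 1%:M by rewrite /E scale0r expm0 -scalar_mx_block.
have dE u : dsubmx (E u) = dsubmx (block_mx 1%:M 0 0 1%:M : 'M[R]_(n + 1)).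
  rewrite -E0; apply: (is_derive0_mx_cst (F := dsubmx \o E)) => t'.
  apply: is_derive_eq (is_derive_linear dsubmx (E_sol t')) _.
  by rewrite mulE /= block_mxEv col_mxKd row_mx0.
have dlE u : dlsubmx (E u) = 0 by rewrite /dlsubmx dE block_mxEv col_mxKd row_mxKl.
have drE u : drsubmx (E u) = 1%:M by rewrite /drsubmx dE block_mxEv col_mxKd row_mxKr.
have ulE_sol (u : R) : is_derive u 1 (lsubmx \o (usubmx \o E)) (a *m ulsubmx (E u)).
  apply: is_derive_eq (is_derive_linear lsubmx (is_derive_linear usubmx (E_sol u))) _.
  by rewrite mulE /= -/(ulsubmx _) block_mxKul dlE mulmx0 addr0.
exists (ursubmx (E t)); rewrite -[LHS](submxK (E t)) dlE drE; congr block_mx.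
have := linear_ode_flow ulE_sol 0 t; rewrite add0r /= -!/(ulsubmx _) => ->.
by rewrite E0 block_mxKul mulmx1.
Qed.

Lemma gel_rcons s p : gel (rcons s p) = expm (p.2 *: Mhat p.1) *m gel s.
Proof. exact: (transition_rcons Mhat). Qed.

Lemma Phi_rcons s p : Phi (rcons s p) = expm (p.2 *: Au p.1) *m Phi s.
Proof. exact: (transition_rcons Au). Qed.

Lemma gel_block s : exists b, gel s = block_mx (Phi s) b 0 1%:M.
Proof.
elim/last_ind: s => [|s p [b IHs]]; first by exists 0; rewrite -scalar_mx_block.
have [b' E] := expm_block (Au p.1) (C *m p.1 + d) p.2.
exists (expm (p.2 *: Au p.1) *m b + b').
rewrite gel_rcons IHs Phi_rcons.
by rewrite /Defs.Mhat E mulmx_block !(mul0mx, mulmx0, addr0, add0r, mulmx1, mul1mx).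
Qed.

Lemma Phi_cat s1 s2 : Phi (s1 ++ s2) = Phi s2 *m Phi s1.
Proof. exact: (transition_cat Au). Qed.

Lemma Phi_mul_neq0 s x : x != 0 -> Phi s *m x != 0.
Proof.
have uPhi : Phi s \in unitmx by exact: transition_unit.
by apply: contraNneq => Phix; rewrite -[x](mulKmx uPhi) Phix mulmx0.
Qed.

Lemma gel_mul_col s x : exists y, gel s *m col_mx x 1 = col_mx y 1.
Proof.
have [b ->] := gel_block s; exists (Phi s *m x + b).
by rewrite mul_block_col mul0mx add0r !mulmx1.
Qed.

Lemma gel_mul_col0 s x : gel s *m col_mx x 0 = col_mx (Phi s *m x) 0.
Proof. by have [b ->] := gel_block s; rewrite mul_block_col !mulmx0 mul0mx !addr0. Qed.

Lemma Faff_col w t x : col_mx (Faff w t x) 1 = expm (t *: Mhat w) *m col_mx x 1.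
Proof.
have [y] := gel_mul_col [:: (w, t)] x; rewrite /Defs.gel /= mulmx1 /Defs.Faff => ->.
by rewrite col_mxKu.
Qed.

Lemma run_aff_col s x : col_mx (run Faff s x) 1 = gel s *m col_mx x 1.
Proof.
elim/last_ind: s => [|s p IHs]; first by rewrite [gel _]/(1%:M) mul1mx.
by rewrite -cats1 run_cat /= Faff_col IHs mulmxA cats1 gel_rcons.
Qed.

Lemma run_hom s x : run Fhom s x = Phi s *m x.
Proof.
elim/last_ind: s => [|s p IHs]; first by rewrite [Phi _]/(1%:M) mul1mx.
by rewrite -cats1 run_cat /= /Defs.Fhom IHs mulmxA cats1 Phi_rcons.
Qed.

Lemma run_aff_fixed s y : run Faff s y = y <-> gel s *m col_mx y 1 = col_mx y 1.
Proof. by rewrite -run_aff_col; split=> [->|/eq_col_mx[]]. Qed.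

Lemma run_aff_fixed_exists s : 1%:M - Phi s \in unitmx -> exists y, run Faff s y = y.
Proof.
move=> us; have [b gelE] := gel_block s; exists (invmx (1%:M - Phi s) *m b).
apply/run_aff_fixed; set y := invmx _ *m b.
rewrite gelE mul_block_col mul0mx add0r !mulmx1; congr col_mx.
have : (1%:M - Phi s) *m y = b by rewrite mulKVmx.
by rewrite mulmxBl mul1mx => <-; rewrite addrC subrK.
Qed.

Lemma run_aff_fixed_line s x y c : run Faff s y = y -> Phi s *m x = x ->
  run Faff s (y + c *: x) = y + c *: x.
Proof.
move=> /run_aff_fixed fix_y fix_x; apply/run_aff_fixed.
have -> : col_mx (y + c *: x) 1 = col_mx y 1 + c *: col_mx x 0.
  by rewrite scale_col_mx add_col_mx scaler0 addr0.
by rewrite mulmxDr fix_y -scalemxAr gel_mul_col0 fix_x.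
Qed.

Lemma gel_fixed_vector s (v : 'cV[R]_(n + 1)) : v != 0 -> gel s *m v = v ->
  (exists y, run Faff s y = y) \/
  exists u, [/\ u != 0, Phi s *m u = u & v = col_mx u 0].
Proof.
rewrite -[v]vsubmxK [dsubmx v]mx11_scalar; set u := usubmx v; set c := dsubmx v 0 0.
have [->|c0] := eqVneq c 0; rewrite ?raddf0 => v0 fix_v.
  right; exists u; split=> //; first by apply: contraNneq v0 => ->; rewrite col_mx0.
  by move: fix_v; rewrite gel_mul_col0 => /eq_col_mx[].
left; exists (c^-1 *: u); apply/run_aff_fixed.
suff -> : col_mx (c^-1 *: u) 1 = c^-1 *: col_mx u c%:M by rewrite -scalemxAr fix_v.
by rewrite scale_col_mx scale_scalar_mx mulVf.
Qed.

Lemma Fhom_flow : is_flow Fhom.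
Proof.
split=> [w x|w a b x|w t]; rewrite /Defs.Fhom.
- by rewrite scale0r expm0 mul1mx.
- by rewrite mulmxA -expmDZ.
- exact: linear_mx_continuous.
Qed.

Lemma col_mx1_continuous : continuous (fun x => col_mx x (1 : 'cV[R]_1)).
Proof.
by move=> x; apply: (@cvg_col_mx _ _ (nbhs x)); [exact: cvg_id|exact: cvg_cst].
Qed.

Lemma Faff_flow : is_flow Faff.
Proof.
split=> [w x|w a b x|w t x].
- by rewrite /Defs.Faff scale0r expm0 mul1mx col_mxKu.
- by rewrite {1}/Defs.Faff Faff_col mulmxA -expmDZ.
- apply: (@continuous_comp _ _ _ (fun x => col_mx x (1 : 'cV[R]_1))
    (usubmx \o mulmx (expm (t *: Mhat w)))); first exact: col_mx1_continuous.
  exact: linear_mx_continuous.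
Qed.

Lemma Au_bounded : (exists K : R, forall w, Om w -> mxnorm w <= K) ->
  exists K, forall w, Om w -> `|Au w| <= K.
Proof.
move=> [K Om_K]; exists (`|A| + \sum_i K * `|B i|) => w /Om_K; rewrite mxnormE => w_K.
apply: le_trans (ler_normD _ _) _; rewrite lerD2l.
apply: le_trans (ler_norm_sum _ _ _) _; apply: ler_sum => i _; rewrite normrZ ler_wpM2r //.
by apply: le_trans w_K; exact: mx_entry_norm_le.
Qed.

Lemma Phi_short_words : (exists K : R, forall w, Om w -> mxnorm w <= K) ->
  Phi s @[s --> short_words Om] --> (1%:M : 'M[R]_n).
Proof. by move=> /Au_bounded[K]; exact: transition_short_words. Qed.

Lemma near_unit_sub1_Phi s : (exists K : R, forall w, Om w -> mxnorm w <= K) ->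
  1%:M - Phi s \in unitmx -> \forall g \near short_words Om, 1%:M - Phi g *m Phi s \in unitmx.
Proof.
move=> Om_bounded unit_s.
have : \det (1%:M - Phi g *m Phi s) @[g --> short_words Om] --> \det (1%:M - Phi s).
  have cvg_sub : 1%:M - Phi g *m Phi s @[g --> short_words Om] --> 1%:M - 1%:M *m Phi s.
    apply: cvgB; first exact: cvg_cst.
    by apply: cvg_mulmx (Phi_short_words Om_bounded) _; exact: cvg_cst.
  by rewrite mul1mx in cvg_sub; exact: (cvg_comp _ _ cvg_sub (@det_continuous _ _ _)).
move/cvgr_neq0; rewrite -unitfE -unitmxE => /(_ unit_s).
by apply: filterS => g; rewrite unitmxE unitfE.
Qed.

Lemma aff_locally_reachable s x : ARC_aff A B C d Om -> admissible Om s ->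
  spanning_word Mhat Om s -> locally_reachable Faff Om x (run Faff s x).
Proof.
move=> arc ads span_s.
pose Pr : 'M[R]_(n, n + 1) := row_mx 1%:M 0.
have PrE (v : 'cV[R]_(n + 1)) : Pr *m v = usubmx v.
  by rewrite -{1}(vsubmxK v) mul_row_col mul1mx mul0mx addr0.
have Pr_run s' z : Pr *m (transition Mhat s' *m col_mx z 1) = run Faff s' z.
  by rewrite PrE -[transition _ _]/(gel s') -run_aff_col col_mxKu.
have onto y : exists2 Z, liealg [set Mhat w | w in Om] Z &
    Pr *m (Z *m (transition Mhat s *m col_mx x 1)) = y.
  have [Z LZ ZE] := arc (run Faff s x) y; exists Z => //.
  by rewrite PrE -[transition _ _]/(gel s) -run_aff_col.
have [[U V] [/= nU nV] UV] := near_reachable ads span_s onto; rewrite Pr_run in nV.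
exists ((fun z => col_mx z 1) @^-1` U, V); first by split=> //; exact: col_mx1_continuous nU.
move=> [z y] [/= Uz Vy]; have /= [s' ads' <-] := UV (col_mx z 1, y) (conj Uz Vy).
by rewrite Pr_run; exact: orbit_run.
Qed.

Lemma hom_locally_reachable s x : ARC_hom A B Om -> admissible Om s ->
  spanning_word Au Om s -> x != 0 -> locally_reachable Fhom Om x (run Fhom s x).
Proof.
move=> arc ads span_s x0.
have onto y : exists2 Z, liealg [set Au w | w in Om] Z &
    1%:M *m (Z *m (transition Au s *m x)) = y.
  by have [Z LZ ZE] := arc _ (Phi_mul_neq0 s x0) y; exists Z; rewrite ?mul1mx.
have := near_reachable ads span_s onto; rewrite mul1mx -[transition _ _]/(Phi s) -run_hom.
apply: filterS => -[z y] /= [s' ads' <-].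
by rewrite mul1mx -[transition _ _]/(Phi s') -run_hom; exact: orbit_run.
Qed.

Lemma closure_embedP_line (D : set 'cV[R]_n) x y :
  (forall c, D (y + c *: x)) -> closure (embedP D) (col_mx x 0).
Proof.
move=> lineD V nV.
have cvg_line : col_mx x 0 + r *: col_mx y (1 : 'cV[R]_1) @[r --> 0^'+] --> col_mx x 0.
  rewrite -[X in _ --> X]addr0 -[X in _ + X](scale0r (col_mx y (1 : 'cV[R]_1))).
  apply: cvg_at_right_filter; apply: cvgD; first exact: cvg_cst.
  by apply: cvgZr_tmp; exact: cvg_id.
near (0 : R)^'+ => r; have r0 : r != 0 by rewrite gt_eqF.
exists (col_mx x 0 + r *: col_mx y 1); split; last by near: r; exact: cvg_line nV.
exists (y + r^-1 *: x); split=> //; exists r => //.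
by rewrite !scale_col_mx add_col_mx add0r scalerDr scalerA mulfV // scale1r addrC.
Unshelve. all: by end_near. Qed.

Lemma boundary_at_infinity (D : set 'cV[R]_n) x : x != 0 ->
  closure (embedP D) (col_mx x 0) -> boundaryP (embedP D) (col_mx x 0).
Proof.
move=> x0 clD.
have one_neq0 : (1 : 'cV[R]_1) != 0 by exact: oner_neq0.
have colx0 : col_mx x (0 : 'cV[R]_1) != 0.
  by apply: contraNneq x0; rewrite -col_mx0 => /eq_col_mx[-> _].
split.
  split=> // e e0; have [v Dv xv] : exists2 v, embedP D v & mxnorm (col_mx x 0 - v) < e.
    by have := clD; rewrite -closureRE; apply.
  exists v; split=> //; split; last by exists 1; rewrite ?oner_neq0 // scale1r.
  have [y [_ [c c0 ->]]] := Dv; rewrite scaler_eq0 (negPf c0) /=.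
  by apply: contraNneq one_neq0; rewrite -col_mx0 => /eq_col_mx[_ ->].
move=> [_ [e e0 sub]].
have [y [_ [c c0]]] : embedP D (col_mx x 0).
  apply: sub; split=> //; exists 1; first exact: oner_neq0.
  by rewrite scale1r subrr mxnormE normr0.
rewrite scale_col_mx => /eq_col_mx[_ /esym/eqP].
by rewrite scaler_eq0 (negPf c0) (negPf one_neq0).
Qed.

End AffineSystems.

Section ScaledWords.
Context {R : realType}.
Variables (m : nat) (Om : set 'cV[R]_m).
Implicit Types s : seq ('cV[R]_m * R).

Definition scale_word (c : R) s := [seq (p.1, c * p.2) | p <- s].

Lemma scale_word_admissible c s : 0 < c -> admissible Om s -> admissible Om (scale_word c s).
Proof. by move=> c0 ads _ /mapP[p /ads[Omp p0] ->]; split=> //=; rewrite mulr_gt0. Qed.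

Lemma scale_word1 s : scale_word 1 s = s.
Proof. by rewrite -[RHS]map_id; apply: eq_map => -[w t]; rewrite /= mul1r. Qed.

Lemma transition_scale_word0 k (M : 'cV[R]_m -> 'M[R]_k) s :
  transition M (scale_word 0 s) = 1%:M.
Proof.
elim: s => [//|p s IHs].
by rewrite /= transition_cons [transition _ _]IHs mul0r scale0r expm0 mulmx1.
Qed.

Lemma bohl_transition_scale_word k (M : 'cV[R]_m -> 'M[R]_k) a b s :
  bohl_mx (fun t => transition M (scale_word (a + t * b) s)).
Proof.
elim: s => [|p s IHs]; first exact: bohl_mx_cst.
under eq_fun do rewrite /= transition_cons /= -scalerA.
by apply: bohl_mulmx IHs _; exact: bohl_expm.
Qed.

Definition deformed_loop s rho saff shom (t : R) :=
  (scale_word t s ++ scale_word (1 - t) rho) ++ saff ++ scale_word (1 - t) shom.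

Lemma bohl_transition_deformed_loop k (M : 'cV[R]_m -> 'M[R]_k) s rho saff shom :
  bohl_mx (fun t => transition M (deformed_loop s rho saff shom t)).
Proof.
have scaleE g (t : R) : scale_word t g = scale_word (0 + t * 1) g by rewrite add0r mulr1.
have oppE (t : R) : 1 - t = 1 + t * -1 by rewrite mulrN1.
under eq_fun do rewrite /deformed_loop !transition_cat oppE (scaleE s).
have bohl_opp g : bohl_mx (fun t => transition M (scale_word (1 + t * -1) g)).
  exact: bohl_transition_scale_word.
apply: bohl_mulmx; apply: bohl_mulmx => //; last exact: bohl_transition_scale_word.
exact: bohl_mx_cst.
Qed.

Lemma transition_deformed_loop0 k (M : 'cV[R]_m -> 'M[R]_k) s rho saff shom :
  transition M (deformed_loop s rho saff shom 0) = transition M (rho ++ saff ++ shom).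
Proof.
by rewrite /deformed_loop subr0 !scale_word1 !transition_cat transition_scale_word0 mulmx1.
Qed.

Lemma transition_deformed_loop1 k (M : 'cV[R]_m -> 'M[R]_k) s rho saff shom :
  transition M (deformed_loop s rho saff shom 1) = transition M saff *m transition M s.
Proof.
rewrite /deformed_loop subrr scale_word1 !transition_cat !transition_scale_word0.
by rewrite !mul1mx.
Qed.

End ScaledWords.

Section LimitFixedVector.
Context {R : realType}.
Variables (n : nat) (T : Type) (U : set_system T).
Context {UU : UltraFilter U}.
Variables (G : T -> 'M[R]_(n + 1)) (G0 : 'M[R]_(n + 1)) (D : set 'cV[R]_n).

(* In projective space the points [y : 1] cluster along the ultrafilter. *)
Lemma limit_fixed_vector : G @ U --> G0 ->
  (\forall t \near U, exists y, D y /\ G t *m col_mx y 1 = col_mx y 1) ->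
  exists v, [/\ v != 0, G0 *m v = v & closure (embedP D) v].
Proof.
move=> G_G0 near_fix.
have /choice[y fix_y] : forall t, exists y : 'cV[R]_n,
    (exists y, D y /\ G t *m col_mx y 1 = col_mx y 1) ->
    D y /\ G t *m col_mx y 1 = col_mx y 1.
  move=> t; have [[y fix_y]|nofix] := pselect (exists y, D y /\ G t *m col_mx y 1 = col_mx y 1).
    by exists y.
  by exists 0.
pose c t := `|col_mx (y t) (1 : 'cV[R]_1)|^-1.
have c0 t : c t != 0.
  rewrite invr_eq0 normr_eq0 -col_mx0; apply/negP => /eqP/eq_col_mx[_ /eqP].
  by rewrite (negPf (oner_neq0 _)).
pose u t := c t *: col_mx (y t) (1 : 'cV[R]_1).
have u1 t : `|u t| = 1.
  by rewrite /u normrZ ger0_norm ?invr_ge0 // mulVf // -invr_eq0; exact: c0.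
have [v [v1 clv]] : [set v : 'cV[R]_(n + 1) | `|v| = 1] `&` cluster (u @ U) !=set0.
  by apply: compact_unit_sphere; apply: nearW.
have u_v : u @ U --> v.
  move=> V nV; have [//|UnV] := in_ultra_setVsetC (u @^-1` V) UU.
  by have [w []] := clv _ V (UnV : (u @ U) (~` V)) nV.
have v0 : v != 0 by rewrite -normr_eq0 v1 oner_neq0.
exists v; split=> //.
  have Gu_v : G t *m u t @[t --> U] --> v.
    apply: cvg_trans u_v; apply: near_eq_cvg; apply: filterS near_fix => t /fix_y[_ fix_t].
    by rewrite /u -scalemxAr fix_t.
  exact: (cvg_unique (@norm_hausdorff _ _) (cvg_mulmx G_G0 u_v) Gu_v).
apply: (closed_cvg _ (@closed_closure _ (embedP D)) _ v u_v).
apply: filterS near_fix => t /fix_y[Dy _]; apply: subset_closure.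
by exists (y t); split=> //; exists (c t).
Qed.

End LimitFixedVector.

Lemma eigenvalue1_unitmx (F : fieldType) n (P : 'M[F]_n) :
  ~~ eigenvalue P 1 -> 1%:M - P \in unitmx.
Proof.
rewrite /eigenvalue negbK /eigenspace kermx_eq0 row_free_unit.
by rewrite -opprB -scaleN1r unitmxZ ?unitrN1.
Qed.

Lemma line_avoids0 (F : fieldType) (V : lmodType F) (x v : V) c : x != 0 ->
  (forall a, v != a *: x) -> x + c *: (v - x) != 0.
Proof.
move=> x0 v_x; have [->|c0] := eqVneq c 0; first by rewrite scale0r addr0.
have := v_x (1 - c^-1); apply: contraNneq => /(congr1 (fun y => c^-1 *: y)).
rewrite scaler0 scalerDr scalerA mulVf // scale1r => line0.
by rewrite scalerBl scale1r -subr_eq0 opprB addrCA line0.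
Qed.

Section ControlSetsAtInfinity.
Context {R : realType}.
Variables (n m : nat).
Variables (A : 'M[R]_n) (B : 'I_m -> 'M[R]_n) (C : 'M[R]_(n, m)) (d : 'cV[R]_n).
Variable Om : set 'cV[R]_m.
Implicit Types (s : seq ('cV[R]_m * R)) (w : 'cV[R]_m) (x y : 'cV[R]_n).

Local Notation Au := (Au A B).
Local Notation Mhat := (Mhat A B C d).
Local Notation Fhom := (Fhom A B).
Local Notation Faff := (Faff A B C d).
Local Notation Phi := (Phi A B).
Local Notation gel := (gel A B C d).

Hypothesis arc_aff : ARC_aff A B C d Om.
Hypothesis arc_hom : ARC_hom A B Om.

Record spanning_loop (rho saff shom : seq ('cV[R]_m * R)) x : Prop := SpanningLoop {
  loop_neq0 : x != 0;
  loop_rho_admissible : admissible Om rho;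
  loop_saff_admissible : admissible Om saff;
  loop_saff_neq0 : saff != [::];
  loop_saff_span : spanning_word Mhat Om saff;
  loop_shom_admissible : admissible Om shom;
  loop_shom_span : spanning_word Au Om shom;
  loop_fixed : Phi (rho ++ saff ++ shom) *m x = x }.

Lemma spanning_loop_exists s (RD : set 'cV[R]_n) :
  (exists K : R, forall w, Om w -> mxnorm w <= K) -> Om 0 -> 1%:M - Phi s \in unitmx ->
  control_set Fhom Om [set x | x != 0] RD -> has_interior RD ->
  exists rho saff shom x,
    [/\ spanning_loop rho saff shom x, RD x & 1%:M - Phi saff *m Phi s \in unitmx].
Proof.
move=> Om_bounded Om0 unit_s [[RD_neq0 _ _ RD_cl] _] /has_interiorP[z RDz_nbhs].
have RDz := nbhs_singleton RDz_nbhs.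
have near_RD : \forall g \near short_words Om, RD (Phi g *m z).
  have : Phi g *m z @[g --> short_words Om] --> 1%:M *m z.
    by apply: cvg_mulmx (Phi_short_words A B Om_bounded) _; exact: cvg_cst.
  by rewrite mul1mx; apply.
have near_cat : \forall start \near short_words Om, \forall saff \near short_words Om,
    \forall shom \near short_words Om, RD (Phi (start ++ saff ++ shom) *m z).
  by apply: filterS (near_short_words_cat near_RD) => start /near_short_words_cat.
have [start [_ ad_start near_saff span_start]] := spanning_word_exists Au Om0 near_cat.
have [saff [saff_neq0 ad_saff [near_shom unit_saff] span_saff]] :=
  spanning_word_exists Mhat Om0 (filterI near_saff (near_unit_sub1_Phi Om_bounded unit_s)).
have [shom [_ ad_shom RDx span_shom]] := spanning_word_exists Au Om0 near_shom.
have z0 : z != 0 by exact: RD_neq0.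
set x := Phi (start ++ saff ++ shom) *m z in RDx.
have [|rho ad_rho rhoE] := @orbit_admissible _ _ _ _ Om (Fhom_flow A B) x (run Fhom start z).
  apply: locally_reachable_closure (hom_locally_reachable arc_hom ad_start span_start z0).
  by rewrite -closureRE; exact: RD_cl.
exists rho, saff, shom, x; split=> //; split=> //.
  exact: RD_neq0.
have return_start : Phi rho *m x = Phi start *m z by rewrite -run_hom -rhoE run_hom.
by rewrite Phi_cat -mulmxA return_start mulmxA -Phi_cat.
Qed.

Lemma aff_fixed_locally_reachable pre s post y : admissible Om pre -> admissible Om s ->
  admissible Om post -> spanning_word Mhat Om s -> run Faff (pre ++ s ++ post) y = y ->
  locally_reachable Faff Om y y.
Proof.
move=> ad_pre ads ad_post span_s fix_y; rewrite -{2}fix_y !run_cat.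
apply: (locally_reachable_extend (Faff_flow A B C d) ad_pre ad_post).
exact: aff_locally_reachable arc_aff ads span_s.
Qed.

Lemma hom_fixed_locally_reachable pre s y : admissible Om pre -> admissible Om s ->
  spanning_word Au Om s -> y != 0 -> Phi (pre ++ s) *m y = y ->
  locally_reachable Fhom Om y y.
Proof.
move=> ad_pre ads span_s y0 fix_y; rewrite -{2}fix_y -run_hom run_cat.
apply: (@locally_reachable_extend _ _ _ _ _ (Fhom_flow A B) pre [::]) => //.
by apply: hom_locally_reachable => //; rewrite run_hom; exact: Phi_mul_neq0.
Qed.

Lemma hom_fixed_ctrl_pre s y : s != [::] -> admissible Om s -> y != 0 -> Phi s *m y = y ->
  ctrl_pre Fhom Om [set x | x != 0] (mutually_reachable Fhom Om y).
Proof.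
move=> s0 ads y0; rewrite -run_hom => fix_y.
apply: (mutually_reachable_ctrl_pre (Fhom_flow A B) s0 ads fix_y).
by move=> z /(orbit_admissible (Fhom_flow A B))[s' _ ->]; rewrite run_hom; exact: Phi_mul_neq0.
Qed.

(* The loop fixes every point of the line through [x] and [v], and this line avoids 0. *)
Lemma fixed_direction_mem rho saff shom x (RD PD : set 'cV[R]_n) v :
  spanning_loop rho saff shom x -> control_set Fhom Om [set x | x != 0] RD -> RD x ->
  cone PD -> RD `<=` PD -> v != 0 -> Phi (rho ++ saff ++ shom) *m v = v -> PD v.
Proof.
move=> loop cRD RDx [_ scalePD] RD_PD v0 fix_v.
have [[a vE]|v_x] := pselect (exists a, v = a *: x).
  rewrite vE; apply: scalePD; first exact: RD_PD.
  by apply: contraNneq v0; rewrite vE => ->; rewrite scale0r.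
have line_neq0 c : x + c *: (v - x) != 0.
  by apply: line_avoids0 (loop_neq0 loop) _ => a; apply/eqP => vE; apply: v_x; exists a.
have fix_line c : Phi (rho ++ saff ++ shom) *m (x + c *: (v - x)) = x + c *: (v - x).
  by rewrite mulmxDr -scalemxAr mulmxBr (loop_fixed loop) fix_v.
have ad_pre : admissible Om (rho ++ saff).
  by apply: admissible_cat; [exact: loop_rho_admissible loop|exact: loop_saff_admissible loop].
have line_reach c : mutually_reachable Fhom Om x (x + c *: (v - x)).
  apply: locally_reachable_line => c'.
  apply: (hom_fixed_locally_reachable ad_pre (loop_shom_admissible loop)
    (loop_shom_span loop)) => //.
  by rewrite -catA.
apply: RD_PD; rewrite -(subrK x v) addrC -[v - x]scale1r.
apply: (control_set_absorbs (Fhom_flow A B) cRD RDx _ (mutually_reachable_refl _ _ _)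
  (line_reach 1)).
apply: hom_fixed_ctrl_pre (loop_neq0 loop) (loop_fixed loop).
  by have := loop_saff_neq0 loop; case: (rho) => //; case: (saff).
by rewrite catA; exact: admissible_cat ad_pre (loop_shom_admissible loop).
Qed.

Lemma deformed_loop_unit_frequently s rho saff shom : 1%:M - Phi saff *m Phi s \in unitmx ->
  ~ \forall t \near 0^'+, ~ 1%:M - Phi (deformed_loop s rho saff shom t) \in unitmx.
Proof.
rewrite unitmxE unitfE => /eqP u1 near_singular; apply: u1.
pose f t := \det (1%:M - Phi (deformed_loop s rho saff shom t)).
have bohl_f : bohl f.
  apply: bohl_det; apply: bohl_mxB (bohl_mx_cst _) _.
  exact: (bohl_transition_deformed_loop Au s rho saff shom).
have near_f0 : \forall t \near 0^'+, f t = 0.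
  by apply: filterS near_singular => t /negP; rewrite unitmxE unitfE => /negPn/eqP.
rewrite -(bohl_near0_eq0 bohl_f near_f0 1) /f.
by rewrite -[Phi (deformed_loop _ _ _ _ _)]/(transition Au _) transition_deformed_loop1.
Qed.

Lemma control_set_of_fixed_point pre s post y : admissible Om pre -> admissible Om s ->
  admissible Om post -> s != [::] -> spanning_word Mhat Om s ->
  run Faff (pre ++ s ++ post) y = y ->
  exists D, [/\ control_set Faff Om setT D, has_interior D & mutually_reachable Faff Om y `<=` D].
Proof.
move=> ad_pre ads ad_post s0 span_s fix_y.
apply: (control_set_of_loop (Faff_flow A B C d) (s := pre ++ s ++ post)) => //.
- by case: (pre) => //; case: (s) s0.
- by do 2 apply: admissible_cat => //.
- exact: aff_fixed_locally_reachable fix_y.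
Qed.

Lemma control_set_of_fixed_line rho saff shom x y : spanning_loop rho saff shom x ->
  run Faff (rho ++ saff ++ shom) y = y ->
  exists D, [/\ control_set Faff Om setT D, has_interior D & closure (embedP D) (col_mx x 0)].
Proof.
move=> loop fix_y.
have [D [cD iD yD]] := control_set_of_fixed_point
  (loop_rho_admissible loop) (loop_saff_admissible loop) (loop_shom_admissible loop)
  (loop_saff_neq0 loop) (loop_saff_span loop) fix_y.
exists D; split=> //; apply: (closure_embedP_line (y := y)) => c; apply: yD.
apply: (locally_reachable_line (F := Faff)) => c'.
apply: (aff_fixed_locally_reachable (loop_rho_admissible loop) (loop_saff_admissible loop)
  (loop_shom_admissible loop) (loop_saff_span loop)).
exact: run_aff_fixed_line fix_y (loop_fixed loop).
Qed.

Lemma control_set_of_deformed_loop s rho saff shom x t : spanning_loop rho saff shom x ->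
  admissible Om s -> 0 < t -> t < 1 -> 1%:M - Phi (deformed_loop s rho saff shom t) \in unitmx ->
  exists2 D, control_set Faff Om setT D /\ has_interior D &
    exists y, D y /\ gel (deformed_loop s rho saff shom t) *m col_mx y 1 = col_mx y 1.
Proof.
move=> loop ads t0 t1 /(run_aff_fixed_exists C d)[y fix_y].
have sub_t : 0 < 1 - t by rewrite subr_gt0.
have ad_pre : admissible Om (scale_word t s ++ scale_word (1 - t) rho).
  by apply: admissible_cat; apply: scale_word_admissible => //; exact: loop_rho_admissible loop.
have [D [cD iD yD]] := control_set_of_fixed_point ad_pre (loop_saff_admissible loop)
  (scale_word_admissible sub_t (loop_shom_admissible loop)) (loop_saff_neq0 loop)
  (loop_saff_span loop) fix_y.
exists D => //; exists y; split; last exact/run_aff_fixed.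
by apply: yD; exact: mutually_reachable_refl.
Qed.

Lemma control_set_of_deformation s rho saff shom x : spanning_loop rho saff shom x ->
  admissible Om s -> 1%:M - Phi saff *m Phi s \in unitmx ->
  finite_set [set D | control_set Faff Om setT D /\ has_interior D] ->
  exists D v, [/\ control_set Faff Om setT D, has_interior D, v != 0,
    gel (rho ++ saff ++ shom) *m v = v & closure (embedP D) v].
Proof.
move=> loop ads unit_saff finD; pose wd := deformed_loop s rho saff shom.
pose W := within [set t | 1%:M - Phi (wd t) \in unitmx] 0^'+.
have properW : ProperFilter W.
  exact: within_proper (@deformed_loop_unit_frequently s rho saff shom unit_saff).
have [U [UU WU]] := ultraFilterLemma properW.
have U_fix : \forall t \near U, exists2 D, control_set Faff Om setT D /\ has_interior D &
    exists y, D y /\ gel (wd t) *m col_mx y 1 = col_mx y 1.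
  apply: WU; rewrite /W /within /=; near=> t => unit_t.
  exact: control_set_of_deformed_loop loop ads _ _ unit_t.
have [D [cD iD] U_D] := ultra_exists_finite_set UU finD U_fix.
have U_0 : nbhs (0 : R) `<=` U.
  by apply: subset_trans WU => V nV; do 2 apply: filterS (fun t Vt _ => Vt) _.
have gel_cvg : gel (wd t) @[t --> U] --> gel (rho ++ saff ++ shom).
  rewrite -[gel (rho ++ _)](transition_deformed_loop0 Mhat s rho saff shom).
  have := bohl_mx_continuous (bohl_transition_deformed_loop Mhat s rho saff shom).
  by move=> /(_ 0); exact: cvg_comp U_0.
have [v [v0 fix_v clv]] := limit_fixed_vector gel_cvg U_D.
by exists D, v.
Unshelve. all: by end_near. Qed.

Lemma control_set_at_infinity s rho saff shom x : spanning_loop rho saff shom x ->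
  admissible Om s -> 1%:M - Phi saff *m Phi s \in unitmx ->
  finite_set [set D | control_set Faff Om setT D /\ has_interior D] ->
  exists D v, [/\ control_set Faff Om setT D, has_interior D, v != 0,
    Phi (rho ++ saff ++ shom) *m v = v & boundaryP (embedP D) (col_mx v 0)].
Proof.
move=> loop ads unit_saff finD; have x0 := loop_neq0 loop.
have of_fixed_point y : run Faff (rho ++ saff ++ shom) y = y -> exists D v,
    [/\ control_set Faff Om setT D, has_interior D, v != 0,
    Phi (rho ++ saff ++ shom) *m v = v & boundaryP (embedP D) (col_mx v 0)].
  move=> /(control_set_of_fixed_line loop)[D [cD iD clD]]; exists D, x; split=> //.
    exact: loop_fixed loop.
  exact: boundary_at_infinity.
have [D [v [cD iD v0 fix_v clD]]] := control_set_of_deformation loop ads unit_saff finD.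
have [[y /of_fixed_point//]|[u [u0 fix_u vE]]] := gel_fixed_vector v0 fix_v.
exists D, u; split=> //; by apply: boundary_at_infinity; rewrite -?vE.
Qed.

End ControlSetsAtInfinity.

Theorem theorem6p4 (R : realType) (n m : nat)
  (A : 'M[R]_n) (B : 'I_m -> 'M[R]_n) (C : 'M[R]_(n, m)) (d : 'cV[R]_n)
  (Om : set 'cV[R]_m) :
  (exists M : R, forall w, Om w -> mxnorm w <= M) ->
  Om 0 ->
  ARC_aff A B C d Om ->
  ARC_hom A B Om ->
  (exists s : seq ('cV[R]_m * R),
     [/\ s != [::], admissible Om s,
         in_int_S A B C d Om (gel A B C d s) &
         ~~ eigenvalue (Phi A B s) 1]) ->
  finite_set [set D | control_set (Faff A B C d) Om setT D /\ has_interior D] ->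
  forall RD : set 'cV[R]_n,
    control_set (Fhom A B) Om [set x | x != 0] RD -> has_interior RD ->
  forall PD : set 'cV[R]_n,
    control_setP (Fhom A B) Om PD -> RD `<=` PD ->
  exists D : set 'cV[R]_n,
    [/\ control_set (Faff A B C d) Om setT D, has_interior D &
        exists x, PD x /\ boundaryP (embedP D) (col_mx x 0)].
Proof.
move=> Om_bounded Om0 arc_aff arc_hom [s [_ ads _ eig1]] finD RD cRD iRD.
move=> PD [[conePD _ _ _] _] RD_PD.
have [rho [saff [shom [x [loop RDx unit_saff]]]]] :=
  spanning_loop_exists C d arc_hom Om_bounded Om0 (eigenvalue1_unitmx eig1) cRD iRD.
have [D [v [cD iD v0 fix_v boundary_v]]] := control_set_at_infinity arc_aff loop ads unit_saff finD.
exists D; split=> //; exists v; split=> //.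
exact: (fixed_direction_mem arc_hom loop cRD RDx conePD RD_PD v0).
Qed.
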